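(* Let $n\ge 1$. There exists a unique family of simplices in $\mathbb{E}^n$ generating the group $\widetilde A_n$ (families being counted up to similarity). This family consists of the Coxeter simplices $\widetilde A_n$; that is, every simplex $P\subset\mathbb{E}^n$ generating $\widetilde A_n$ is itself a Coxeter simplex of type $\widetilde A_n$.
   Context: For a (compact, non-degenerate) simplex $P$ in Euclidean space $\mathbb{E}^n$, $G_P$ denotes the group generated by the reflections in the $n+1$ facets (in the hyperplanes spanned by them) of $P$. A simplex is a Coxeter simplex if all its dihedral angles are of the form $\pi/k$ with $k\ge 2$ an integer. A Coxeter diagram of a Coxeter simplex has one node per facet, two nodes being joined by a $(k-2)$-fold edge if the facets form the angle $\pi/k$ (no edge if orthogonal). The Coxeter simplex $\widetilde A_n$, $n\ge 2$, is the one whose Coxeter diagram is a cycle with $n+1$ nodes and simple edges; $\widetilde A_1$ is a segment. $P$ is said to generate $\widetilde A_n$ if $G_P$ is discrete and a fundamental chamber of $G_P$ is a Coxeter simplex $\widetilde A_n$ (of any size). $P$ itself is not assumed to be a Coxeter simplex. If $f_0,\dots,f_n$ are the outward unit normals to the facets of $P$, the family of $P$ is the set of all simplices in $\mathbb{E}^n$ having the same set of vectors $\{\pm f_0,\dots,\pm f_n\}$ as facet normals; any two simplices of one family are similar. Families are classified up to similarity, so counting families means counting similarity classes of simplices. *)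

(* Defs.v *)
From HB Require Import structures.
From mathcomp Require Import all_boot all_order all_algebra.
From mathcomp Require Import all_classical all_reals all_analysis.

Set Implicit Arguments.
Unset Strict Implicit.
Unset Printing Implicit Defensive.

Import Order.TTheory GRing.Theory Num.Theory.
Import numFieldNormedType.Exports.

Local Open Scope classical_set_scope.
Local Open Scope ring_scope.

(* E^n is 'rV[R]_n with the inner product [dot].  The library norm `|x| on
   matrices is the sup norm: it induces the right topology, but distances have
   to be measured with [enorm]. *)
Definition dot {R : realType} {n : nat} (u v : 'rV[R]_n) : R :=
  \sum_i u 0 i * v 0 i.

Definition enorm {R : realType} {n : nat} (u : 'rV[R]_n) : R :=
  Num.sqrt (dot u u).

Definition similarity {R : realType} {n : nat}
    (phi : 'rV[R]_n -> 'rV[R]_n) : Prop :=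
  exists2 k : R, 0 < k &
    forall x y, enorm (phi x - phi y) = k * enorm (x - y).

Definition hyperplane {R : realType} {n : nat} (a : 'rV[R]_n) (b : R) :
    set 'rV[R]_n :=
  [set x | dot a x = b].

Definition reflection {R : realType} {n : nat} (a : 'rV[R]_n) (b : R)
    (x : 'rV[R]_n) : 'rV[R]_n :=
  x - (2 * (dot a x - b) / dot a a) *: a.

Definition reflection_in {R : realType} {n : nat} (H : set 'rV[R]_n)
    (s : 'rV[R]_n -> 'rV[R]_n) : Prop :=
  exists a b, [/\ a != 0, H = hyperplane a b & s = reflection a b].

(* A simplex is given by a labelling of its n + 1 vertices. *)
Definition is_simplex {R : realType} {n : nat} (v : 'I_n.+1 -> 'rV[R]_n) :
    Prop :=
  forall c : 'I_n.+1 -> R,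
    \sum_i c i = 0 -> \sum_i c i *: v i = 0 -> forall i, c i = 0.

Definition simplex_hull {R : realType} {n : nat} (v : 'I_n.+1 -> 'rV[R]_n) :
    set 'rV[R]_n :=
  [set x | exists c : 'I_n.+1 -> R,
    [/\ forall i, 0 <= c i, \sum_i c i = 1 & x = \sum_i c i *: v i]].

(* The affine span of the facet opposite to the vertex [v i]. *)
Definition facet_span {R : realType} {n : nat} (v : 'I_n.+1 -> 'rV[R]_n)
    (i : 'I_n.+1) : set 'rV[R]_n :=
  [set x | exists c : 'I_n.+1 -> R,
    [/\ c i = 0, \sum_j c j = 1 & x = \sum_j c j *: v j]].

Definition is_outward_normal {R : realType} {n : nat}
    (v : 'I_n.+1 -> 'rV[R]_n) (i : 'I_n.+1) (f : 'rV[R]_n) : Prop :=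
  [/\ enorm f = 1,
      forall j k, j != i -> k != i -> dot f (v j - v k) = 0
    & forall j, j != i -> dot f (v i - v j) < 0].

Definition outward_normal {R : realType} {n : nat}
    (v : 'I_n.+1 -> 'rV[R]_n) (i : 'I_n.+1) : 'rV[R]_n :=
  get (is_outward_normal v i).

Definition dihedral_angle {R : realType} {n : nat}
    (v : 'I_n.+1 -> 'rV[R]_n) (i j : 'I_n.+1) : R :=
  pi - acos (dot (outward_normal v i) (outward_normal v j)).

Definition coxeter_simplex {R : realType} {n : nat}
    (v : 'I_n.+1 -> 'rV[R]_n) : Prop :=
  is_simplex v /\
  forall i j, i != j ->
    exists2 k : nat, (2 <= k)%N & dihedral_angle v i j = pi / k%:R.

(* [m i j] is the multiplicity of the edge between the facets i and j. *)
Definition coxeter_diagram {R : realType} {n : nat}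
    (v : 'I_n.+1 -> 'rV[R]_n) (m : 'I_n.+1 -> 'I_n.+1 -> nat) : Prop :=
  forall i j, i != j -> dihedral_angle v i j = pi / (m i j + 2)%:R.

(* [s] lists the nodes in cyclic order; [ordS] is the successor mod N. *)
Definition simple_cycle {N : nat} (m : 'I_N -> 'I_N -> nat) : Prop :=
  exists2 s : 'I_N -> 'I_N, bijective s & forall i j, i != j ->
    m (s i) (s j) = ((j == ordS i) || (i == ordS j) : nat).

(* In dimension 1 every simplex is a segment: its two facets are distinct
   points, which form no dihedral angle. *)
Definition coxeter_simplex_A {R : realType} {n : nat}
    (v : 'I_n.+1 -> 'rV[R]_n) : Prop :=
  if n == 1%N then is_simplex v
  else coxeter_simplex v /\
       exists2 m, coxeter_diagram v m & simple_cycle m.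

Definition transformation_group {T : Type} (G : set (T -> T)) : Prop :=
  [/\ G id,
      forall g h, G g -> G h -> G (g \o h)
    & forall g h, G g -> cancel g h -> cancel h g -> G h].

(* The group G_P. *)
Definition facet_group {R : realType} {n : nat} (v : 'I_n.+1 -> 'rV[R]_n) :
    set ('rV[R]_n -> 'rV[R]_n) :=
  smallest transformation_group
    [set s | exists i, reflection_in (facet_span v i) s].

(* On isometries the compact-open topology is the usual topology of the Lie
   group Isom(E^n). *)
Definition discrete_group {R : realType} {n : nat}
    (G : set ('rV[R]_n -> 'rV[R]_n)) : Prop :=
  G `<=` isolated (G : set {compact-open, 'rV[R]_n -> 'rV[R]_n}).

Definition mirror_union {R : realType} {n : nat}
    (G : set ('rV[R]_n -> 'rV[R]_n)) : set 'rV[R]_n :=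
  [set x | exists H s, [/\ reflection_in H s, G s & H x]].

Definition fundamental_chamber {R : realType} {n : nat}
    (G : set ('rV[R]_n -> 'rV[R]_n)) (C : set 'rV[R]_n) : Prop :=
  exists2 x, ~ mirror_union G x &
    C = closure (connected_component (~` mirror_union G) x).

Definition generates_A {R : realType} {n : nat} (v : 'I_n.+1 -> 'rV[R]_n) :
    Prop :=
  [/\ is_simplex v,
      discrete_group (facet_group v)
    & exists2 w, coxeter_simplex_A w &
        fundamental_chamber (facet_group v) (simplex_hull w)].

Definition facet_normals {R : realType} {n : nat}
    (v : 'I_n.+1 -> 'rV[R]_n) : set 'rV[R]_n :=
  [set f | exists i, f = outward_normal v i \/ f = - outward_normal v i].

Definition family {R : realType} {n : nat} (v : 'I_n.+1 -> 'rV[R]_n) :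
    set ('I_n.+1 -> 'rV[R]_n) :=
  [set w | is_simplex w /\ facet_normals w = facet_normals v].

Definition is_family {R : realType} {n : nat}
    (F : set ('I_n.+1 -> 'rV[R]_n)) : Prop :=
  exists2 v, is_simplex v & F = family v.

Definition similar_families {R : realType} {n : nat}
    (F F' : set ('I_n.+1 -> 'rV[R]_n)) : Prop :=
  exists2 phi, similarity phi & F' = [set phi \o v | v in F].

(* The [get] in [outward_normal] never falls back to its default value. *)
Lemma dotZ {R : realType} {n : nat} (a b : R) (u v : 'rV[R]_n) :
  dot (a *: u) (b *: v) = a * b * dot u v.
Proof.
by rewrite /dot mulr_sumr; apply: eq_bigr => i _; rewrite !mxE mulrACA.
Qed.

Lemma dotB {R : realType} {n : nat} (u v w : 'rV[R]_n) :
  dot u (v - w) = dot u v - dot u w.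
Proof.
by rewrite /dot -sumrB; apply: eq_bigr => i _; rewrite !mxE mulrBr.
Qed.

Lemma dot_eq0 {R : realType} {n : nat} (u : 'rV[R]_n) :
  (dot u u == 0) = (u == 0).
Proof.
apply/idP/eqP => [|->]; last by rewrite /dot big1// => i _; rewrite mxE mul0r.
rewrite psumr_eq0 => [/allP u0|i _]; last by rewrite -expr2 sqr_ge0.
apply/rowP => i; rewrite mxE; apply/eqP.
by have := u0 i (mem_index_enum _); rewrite /= mulf_eq0 orbb.
Qed.

Lemma outward_normalP {R : realType} {n : nat} (v : 'I_n.+1 -> 'rV[R]_n)
    (i : 'I_n.+1) : (0 < n)%N -> is_simplex v ->
  is_outward_normal v i (outward_normal v i).
Proof.
move=> n0 sv.
pose A : 'M[R]_(n.+1, n + 1) := row_mx (\matrix_j v j) (const_mx 1).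
have Afree : row_free A.
  rewrite -kermx_eq0; apply/eqP/row_matrixP => k.
  have := sub_kermxP (row_sub k (kermx A)).
  set c := row k _; rewrite row0 mul_mx_row => c0.
  have /eq_row_mx[h1 h2] : row_mx (c *m \matrix_j v j) (c *m const_mx 1) =
      row_mx 0 0 :> 'rV[R]_(n + 1) by rewrite c0 row_mx0.
  apply/rowP => j; rewrite [RHS]mxE; apply: (sv (fun j => c 0 j)).
    have /rowP/(_ 0) := h2; rewrite mxE [RHS]mxE => h; rewrite -[RHS]h.
    by apply: eq_bigr => l _; rewrite [const_mx _ _ _]mxE mulr1.
  rewrite -[RHS]h1 mulmx_sum_row; apply: eq_bigr => l _.
  by rewrite rowK.
have [D AD] : exists D, A *m D = 1%:M by exact/row_freeP.
pose g : 'rV[R]_n := - (usubmx (col i D))^T; pose b := dsubmx (col i D) 0 0.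
have gE j : dot g (v j) = b - (j == i)%:R.
  have : (A *m col i D) j 0 = (j == i)%:R by rewrite colE mulmxA AD mul1mx mxE andbT.
  rewrite -[col i D]vsubmxK mul_row_col => <-; rewrite mxE opprD.
  have -> : (const_mx 1 *m dsubmx (col i D)) j 0 = b.
    by rewrite mxE big_ord1 mxE mul1r.
  rewrite addrCA subrr addr0 /dot mxE -sumrN; apply: eq_bigr => k _.
  by rewrite !mxE mulNr mulrC.
have [j0 j0i] : exists j, j != i.
  exists (lift i (Ordinal n0)); rewrite eq_sym; exact: neq_lift.
have gneq0 : g != 0.
  apply/eqP => g0; have := gE i; have := gE j0.
  rewrite g0 eqxx (negbTE j0i) subr0 /dot !big1 => [<-|k _|k _]; last 2 first.
  - by rewrite mxE mul0r.
  - by rewrite mxE mul0r.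
  by move/eqP; rewrite sub0r eq_sym oppr_eq0 oner_eq0.
have dg0 : 0 < dot g g.
  by rewrite lt_neqAle eq_sym dot_eq0 gneq0 sumr_ge0// => k _; rewrite -expr2 sqr_ge0.
have eg0 : 0 < enorm g by rewrite sqrtr_gt0.
apply: (@getPex _ (is_outward_normal v i)).
exists ((enorm g)^-1 *: g); split.
- rewrite {1}/enorm dotZ -(sqr_sqrtr (ltW dg0)) -/(enorm g).
  by rewrite -invfM -expr2 mulVf ?sqrtr1// expf_neq0// gt_eqF.
- move=> j k ji ki; rewrite -[_ - _]scale1r dotZ dotB !gE (negbTE ji) (negbTE ki).
  by rewrite subrr mulr0.
- move=> j ji; rewrite -[_ - _]scale1r dotZ dotB !gE (negbTE ji) eqxx mulr1.
  by rewrite subr0 addrAC subrr sub0r mulrN1 oppr_lt0 invr_gt0.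
Qed.

(* Main.v *)
(**
The unit normals of a simplex of type A~_n are, up to a common factor, the
consecutive differences [E i - E (i+1)] of the n + 1 vectors [E i] joining
consecutive vertices, and in the coordinates [y |-> dot (E i) y], suitably
normalised, its walls generate a group of permutations and integral
translations.  An element of that group fixing a point of the open simplex is
trivial, so the group is discrete and the simplex is its chamber.

Conversely, let the group of a simplex P be discrete with such a simplex as
chamber.  Discreteness forces the walls of the chamber to be mirrors, so every
point off the hyperplanes [Y i - Y j = m] can be moved by the group into the
open chamber, which meets no mirror.  Hence a mirror is covered by these
hyperplanes, and every normal of P is proportional to a root [E a - E b].  Since
the n + 1 normals of P satisfy one positive relation and no shorter one, the
pairs (a, b) are the arrows of a single (n + 1)-cycle, and P is of type A~_n.
*)
Require Import Defs.
From HB Require Import structures.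
From mathcomp Require Import all_boot all_order all_algebra.
From mathcomp Require Import all_classical all_reals all_analysis.
From mathcomp Require Import perm ring lra.

Set Implicit Arguments.
Unset Strict Implicit.
Unset Printing Implicit Defensive.

Import Order.TTheory GRing.Theory Num.Theory.
Import numFieldNormedType.Exports.

Local Open Scope classical_set_scope.
Local Open Scope ring_scope.

(** * Reflections and simplices *)

(** Angles are traded for the Gram matrix of the normals ([cyclic_normals]), which also covers the
    segment, where no dihedral angle exists. In the converse only the closure of one component of
    the mirror complement is known. Mirrors might a priori accumulate, so no mirror is known to
    contain a facet of the chamber. Mirrors cutting off points just outside a facet converge to its
    wall, but the limit reflection is not yet known to lie in the group; isolation is therefore used
    at the identity, which products of consecutive reflections approach. Moving a point into the
    open alcove needs a margin that survives the motion: the distances of coordinate differences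
    from the integers. Wall reflections permute the coordinates and add integers, so this margin is
    kept and every step of the descent gains a fixed amount. A hyperplane that is no root hyperplane
    contains a line meeting the countably many root hyperplanes in countably many points, hence a
    point with such a margin. A family contains its rescaled copies, so an isometry matching the
    normals is enough for uniqueness. *)

Section Dot.
Variables (R : realType) (n : nat).
Implicit Types (u v w x f : 'rV[R]_n) (a b c d : R).

Lemma dotC u v : dot u v = dot v u.
Proof. by apply: eq_bigr => i _; rewrite mulrC. Qed.

Lemma dotDr u v w : dot u (v + w) = dot u v + dot u w.
Proof. by rewrite /dot -big_split; apply: eq_bigr => i _; rewrite mxE mulrDr. Qed.

Lemma dotDl u v w : dot (u + v) w = dot u w + dot v w.
Proof. by rewrite dotC dotDr !(dotC w). Qed.

Lemma dotZr a u v : dot u (a *: v) = a * dot u v.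
Proof. by rewrite -{1}[u]scale1r dotZ mul1r. Qed.

Lemma dotZl a u v : dot (a *: u) v = a * dot u v.
Proof. by rewrite dotC dotZr dotC. Qed.

Lemma dotNr u v : dot u (- v) = - dot u v.
Proof. by rewrite -scaleN1r dotZr mulN1r. Qed.

Lemma dotNl u v : dot (- u) v = - dot u v.
Proof. by rewrite dotC dotNr dotC. Qed.

Lemma dotBl u v w : dot (u - v) w = dot u w - dot v w.
Proof. by rewrite dotDl dotNl. Qed.

Lemma dot0r u : dot u 0 = 0.
Proof. by rewrite -(scale0r (0 : 'rV[R]_n)) dotZr mul0r. Qed.

Lemma dot0l u : dot 0 u = 0.
Proof. by rewrite dotC dot0r. Qed.

Lemma dot_sumr (I : finType) (P : pred I) (F : I -> 'rV[R]_n) u :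
  dot u (\sum_(i | P i) F i) = \sum_(i | P i) dot u (F i).
Proof.
apply: (big_ind2 (fun x y => dot u x = y)) => [|x1 x2 y1 y2 <- <-|//].
- by rewrite dot0r.
- by rewrite dotDr.
Qed.

Lemma dot_suml (I : finType) (P : pred I) (F : I -> 'rV[R]_n) u :
  dot (\sum_(i | P i) F i) u = \sum_(i | P i) dot (F i) u.
Proof. by rewrite dotC dot_sumr; apply: eq_bigr => i _; rewrite dotC. Qed.

Lemma dot_ge0 u : 0 <= dot u u.
Proof. by apply: sumr_ge0 => i _; rewrite -expr2 sqr_ge0. Qed.

Lemma dot_eq0P u : dot u u = 0 -> u = 0.
Proof. by move/eqP; rewrite dot_eq0 => /eqP. Qed.

Lemma dot_gt0 u : u != 0 -> 0 < dot u u.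
Proof. by move=> u0; rewrite lt_neqAle eq_sym dot_eq0 u0 dot_ge0. Qed.

Lemma sqr_enorm u : enorm u ^+ 2 = dot u u.
Proof. by rewrite sqr_sqrtr // dot_ge0. Qed.

Lemma enorm1_dot u : enorm u = 1 -> dot u u = 1.
Proof. by rewrite -sqr_enorm => ->; rewrite expr1n. Qed.

Lemma unit_dot_itv u v : dot u u = 1 -> dot v v = 1 -> -1 <= dot u v <= 1.
Proof.
move=> u1 v1; have := dot_ge0 (u - v); have := dot_ge0 (u + v).
rewrite !(dotDl, dotDr, dotNl, dotNr) u1 v1 (dotC v u) => h1 h2.
by apply/andP; split; lra.
Qed.

Lemma dot_reflection f d u v :
  dot u (reflection f d v) = dot u v - 2 * (dot f v - d) / dot f f * dot u f.
Proof. by rewrite /reflection dotB dotZr. Qed.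

Lemma reflectionK f d : f != 0 -> cancel (reflection f d) (reflection f d).
Proof.
move=> f0 x; have ff : dot f f != 0 by rewrite dot_eq0.
rewrite {1}/reflection dot_reflection /reflection -addrA -opprD -scalerDl.
set k := (X in X *: f); suff -> : k = 0 by rewrite scale0r subr0.
by rewrite /k; field.
Qed.

Lemma reflection_fix f d x : f != 0 -> reflection f d x = x <-> dot f x = d.
Proof.
move=> f0; have ff : dot f f != 0 by rewrite dot_eq0.
split=> [|fx]; last by rewrite /reflection fx subrr mulr0 mul0r scale0r subr0.
move/(congr1 (dot f)); rewrite dot_reflection -mulrA mulVf // => h.
lra.
Qed.

Lemma reflection_scale c f d x : c != 0 ->
  reflection (c *: f) (c * d) x = reflection f d x.
Proof.
move=> c0; rewrite /reflection dotZl dotZ scalerA; congr (_ - _ *: _).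
have [->|f0] := eqVneq (dot f f) 0; first by rewrite mulr0 invr0 !mulr0 mul0r.
by field; rewrite f0.
Qed.

Lemma reflection_conj f d (a : 'rV[R]_n) b : dot f f = 1 ->
  reflection f d \o reflection a b \o reflection f d =
  reflection (a - (2 * dot a f) *: f) (b - 2 * dot a f * d).
Proof.
move=> f1; apply/funext => x /=.
have a1 : dot (a - (2 * dot a f) *: f) (a - (2 * dot a f) *: f) = dot a a.
  rewrite !(dotBl, dotB, dotZl, dotZr) f1 (dotC f a); ring.
rewrite {2 4}/reflection a1 /reflection f1 !divr1.
rewrite !(dotBl, dotB, dotZl, dotZr) f1 (dotC f a).
set k := _ / dot a a; set k' := _ / dot a a.
have <- : k = k' by rewrite /k /k'; congr (2 * _ / _); ring.
apply/rowP => i; rewrite !mxE; ring.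
Qed.
End Dot.

Section Simplex.
Variables (R : realType) (n : nat) (v : 'I_n.+1 -> 'rV[R]_n).
Hypotheses (hn : (0 < n)%N) (sv : is_simplex v).
Local Notation f := (outward_normal v).

Lemma ordS_neq (i : 'I_n.+1) : ordS i != i.
Proof.
apply/eqP => /(congr1 val) /=; have := ltn_ord i;
  rewrite ltnS leq_eqVlt => /orP[/eqP->|li].
  by rewrite modnn => h; have := hn; rewrite -h.
by rewrite modn_small ?ltnS // => /eqP; rewrite -[X in _ == X]addn0 -addn1 eqn_add2l.
Qed.

(** The distance from [v i] to the opposite facet; [ordS i] only serves as some vertex other than
    [i]. *)
Definition height i : R := dot (f i) (v (ordS i) - v i).

Definition bary i (y : 'rV[R]_n) : R := dot (f i) (v (ordS i) - y) / height i.

Lemma normal_dot1 i : dot (f i) (f i) = 1.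
Proof. by apply: enorm1_dot; case: (outward_normalP i hn sv). Qed.

Lemma normal_neq0 i : f i != 0.
Proof. by rewrite -dot_eq0 normal_dot1 oner_eq0. Qed.

Lemma height_gt0 i : 0 < height i.
Proof.
case: (outward_normalP i hn sv) => _ _ /(_ (ordS i) (ordS_neq i)).
by rewrite /height -opprB dotNr oppr_lt0.
Qed.

Lemma height_neq0 i : height i != 0.
Proof. by rewrite gt_eqF // height_gt0. Qed.

Lemma normal_dot_vertex k i :
  dot (f k) (v i) = dot (f k) (v (ordS k)) - (k == i)%:R * height k.
Proof.
have [<-|ki] := eqVneq k i; first by rewrite mul1r /height dotB; ring.
case: (outward_normalP k hn sv) => _ /(_ (ordS k) i (ordS_neq k));
  rewrite eq_sym ki => /(_ isT).
by rewrite dotB mul0r subr0 => /eqP; rewrite subr_eq0 => /eqP.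
Qed.

Lemma normal_dot_edge k i j :
  dot (f k) (v i - v j) = ((k == j)%:R - (k == i)%:R) * height k.
Proof. rewrite dotB !(normal_dot_vertex k i) (normal_dot_vertex k j); ring. Qed.

(** The square matrix with rows [(v j, 1)] is row free by affine independence, hence of full
    rank. *)
Lemma affine_coords (y : 'rV[R]_n) :
  exists2 c : 'I_n.+1 -> R, \sum_i c i = 1 & y = \sum_i c i *: v i.
Proof.
pose A : 'M[R]_(n.+1, n + 1) := row_mx (\matrix_j v j) (const_mx 1).
have Afree : row_free A.
  rewrite -kermx_eq0; apply/eqP/row_matrixP => k.
  have := sub_kermxP (row_sub k (kermx A)).
  set c := row k _; rewrite row0 mul_mx_row => c0.
  have /eq_row_mx[h1 h2] : row_mx (c *m \matrix_j v j) (c *m const_mx 1) =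
      row_mx 0 0 :> 'rV[R]_(n + 1) by rewrite c0 row_mx0.
  apply/rowP => j; rewrite [RHS]mxE; apply: (@sv (fun j => c 0 j)).
    have /rowP/(_ 0) := h2; rewrite mxE [RHS]mxE => h; rewrite -[RHS]h.
    by apply: eq_bigr => l _; rewrite [const_mx _ _ _]mxE mulr1.
  by rewrite -[RHS]h1 mulmx_sum_row; apply: eq_bigr => l _; rewrite rowK.
have Afull : row_full A by rewrite /row_full (eqP Afree) addn1.
have [c yc] : exists c, row_mx y (const_mx 1 : 'rV_1) = c *m A by apply/submxP/submx_full.
have /eq_row_mx[h1 h2] : row_mx y (const_mx 1 : 'rV_1) =
    row_mx (c *m \matrix_j v j) (c *m (const_mx 1 : 'cV_n.+1)) by rewrite yc mul_mx_row.
exists (fun i => c 0 i); last first.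
  by rewrite h1 mulmx_sum_row; apply: eq_bigr => l _; rewrite rowK.
have /rowP/(_ 0) := h2; rewrite !mxE => ->.
by apply: eq_bigr => l _; rewrite [const_mx _ _ _]mxE mulr1.
Qed.

Lemma bary_comb (c : 'I_n.+1 -> R) k : \sum_i c i = 1 ->
  bary k (\sum_i c i *: v i) = c k.
Proof.
move=> c1; rewrite /bary dotB dot_sumr.
rewrite (eq_bigr (fun i =>
  c i * dot (f k) (v (ordS k)) - (k == i)%:R * (c i * height k))); last first.
  by move=> i _; rewrite dotZr (normal_dot_vertex k i); ring.
rewrite sumrB -mulr_suml c1 mul1r opprB addrCA subrr addr0.
rewrite (bigD1 k) //= big1 => [|i ik]; last by rewrite eq_sym (negbTE ik) mul0r.
by rewrite eqxx mul1r addr0 mulfK // height_neq0.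
Qed.

Lemma sum_bary y : \sum_i bary i y = 1.
Proof.
have [c c1 ->] := affine_coords y; rewrite -[RHS]c1.
by apply: eq_bigr => i _; rewrite bary_comb.
Qed.

Lemma baryE y : y = \sum_i bary i y *: v i.
Proof.
have [c c1 ->] := affine_coords y.
by apply: eq_bigr => i _; rewrite bary_comb.
Qed.

Lemma bary_inj x y : (forall i, bary i x = bary i y) -> x = y.
Proof. by move=> h; rewrite (baryE x) (baryE y); apply: eq_bigr => i _; rewrite h. Qed.

Lemma bary_vertex k i : bary k (v i) = (k == i)%:R.
Proof.
by rewrite /bary dotB (normal_dot_vertex k i) opprB addrCA subrr addr0 mulfK //
  height_neq0.
Qed.

Lemma bary_addr k x u : bary k (x + u) = bary k x - dot (f k) u / height k.
Proof. rewrite /bary !(dotB, dotDr); field; exact: height_neq0. Qed.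

Lemma normals_span u : (forall k, dot (f k) u = 0) -> u = 0.
Proof.
move=> fu; apply: (@addrI _ (v ord0)); rewrite addr0; apply: bary_inj => k.
by rewrite bary_addr fu mul0r subr0.
Qed.

(** The barycentric coordinates sum to 1 at every point, so their linear parts, the normals divided
    by minus the heights, cancel. *)
Lemma normals_relation : \sum_k (height k)^-1 *: f k = 0.
Proof.
apply: dot_eq0P; set u := \sum_k _.
have -> : dot u u = \sum_i dot (f i) u / height i.
  by rewrite {1}/u dot_suml; apply: eq_bigr => i _; rewrite dotZl mulrC.
have := sum_bary (v ord0 + u).
rewrite (eq_bigr _ (fun k _ => bary_addr k _ _)) sumrB sum_bary => h.
by lra.
Qed.

(** The edge [v i - v j] is orthogonal to every normal except those of [i] and [j], so pairing with
    it isolates two coefficients. *)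
Lemma normals_relation_unique (x : 'I_n.+1 -> R) :
  \sum_k x k *: f k = 0 -> forall i j, x i * height i = x j * height j.
Proof.
move=> x0 i j; have : dot (\sum_k x k *: f k) (v i - v j) = 0 by rewrite x0 dot0l.
rewrite dot_suml (eq_bigr (fun k =>
  (k == j)%:R * (x k * height k) - (k == i)%:R * (x k * height k))); last first.
  by move=> k _; rewrite dotZl normal_dot_edge; ring.
rewrite sumrB (bigD1 j) //= big1 => [|k kj]; last by rewrite (negbTE kj) mul0r.
rewrite [X in _ - X](bigD1 i) //= big1 => [|k ki]; last by rewrite (negbTE ki) mul0r.
by rewrite !eqxx !mul1r !addr0 => /eqP; rewrite subr_eq0 => /eqP.
Qed.

(** Makes the [get] in [outward_normal] computable. With [c] matched on one edge through [v i],
    [g - c *: f i] is orthogonal to all edges, hence zero; unit length and orientation then force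
    [c = 1]. *)
Lemma outward_normal_unique i g : is_outward_normal v i g -> g = f i.
Proof.
case=> /enorm1_dot g1 g0 gn.
pose c := dot g (v i - v (ordS i)) / dot (f i) (v i - v (ordS i)).
have fi : dot (f i) (v i - v (ordS i)) < 0.
  by case: (outward_normalP i hn sv) => _ _; apply; rewrite ordS_neq.
have gc j : dot (g - c *: f i) (v j - v (ordS i)) = 0.
  rewrite dotBl dotZl; have [->|ji] := eqVneq j i;
    first by rewrite /c divfK ?subrr // lt_eqF.
  rewrite (g0 _ _ ji (ordS_neq i)) normal_dot_edge.
  by rewrite eq_sym (negbTE (ordS_neq i)) eq_sym (negbTE ji) subrr mul0r mulr0 subrr.
have e : g = c *: f i.
  apply/eqP; rewrite -subr_eq0; apply/eqP/dot_eq0P.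
  set u := g - _ in gc *; rewrite {2}/u.
  have h z : dot u (z - v (ordS i)) = 0.
    rewrite [X in X - _](baryE z) -[v (ordS i)]scale1r -(sum_bary z) scaler_suml
      -sumrB dot_sumr.
    by rewrite big1 // => j _; rewrite -scalerBr dotZr gc mulr0.
  by have := h (u + v (ordS i)); rewrite addrK.
have c0 : 0 < c.
  by rewrite /c nmulr_rgt0 ?invr_lt0 //; apply: gn; rewrite ordS_neq.
move: g1; rewrite e dotZ normal_dot1 mulr1 -expr2 => /eqP.
by rewrite sqrf_eq1 => /orP[/eqP->|/eqP c1]; [rewrite scale1r|rewrite c1 ltr0N1 in c0].
Qed.

Lemma facet_spanE i : facet_span v i = hyperplane (f i) (dot (f i) (v (ordS i))).
Proof.
apply/seteqP; split=> x.
- case=> c [ci c1 ->]; rewrite /hyperplane /=.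
  have := bary_comb i c1; rewrite ci /bary => /eqP.
  by rewrite mulf_eq0 invr_eq0 (negbTE (height_neq0 i)) orbF dotB subr_eq0 => /eqP.
- rewrite /hyperplane /= => fx; exists (bary ^~ x); split; rewrite ?sum_bary //.
  + by rewrite /bary dotB fx subrr mul0r.
  + exact: baryE.
Qed.

Lemma simplex_hullE : simplex_hull v = [set y | forall i, 0 <= bary i y].
Proof.
apply/seteqP; split=> x /=.
- by case=> c [c0 c1 ->] i; rewrite bary_comb.
- by move=> h; exists (bary ^~ x); split; rewrite ?sum_bary //; exact: baryE.
Qed.
End Simplex.

(** * The alcove of type A *)

Section CyclicOrder.
Variable n : nat.

Lemma eq_ord_pred (i j : 'I_n) : (i == ord_pred j) = (ordS i == j).
Proof. by apply/eqP/eqP => [->|<-]; rewrite ?ord_predK ?ordSK. Qed.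

Lemma ordS_val (i : 'I_n.+1) : (i < n)%N -> ordS i = i.+1 :> nat.
Proof. by move=> li /=; rewrite modn_small. Qed.

Lemma ordS_max (i : 'I_n.+1) : i = n :> nat -> ordS i = ord0.
Proof. by move=> e; apply/val_inj; rewrite /= e modnn. Qed.

Lemma ordS_invariant (T : Type) (D : 'I_n.+1 -> T) :
  (forall k, D (ordS k) = D k) -> forall k l, D k = D l.
Proof.
move=> DS; suff h m (lm : (m < n.+1)%N) : D (Ordinal lm) = D ord0.
  by move=> [k lk] [l ll]; rewrite !h.
elim: m lm => [|m IH] lm; first by congr D; apply/val_inj.
rewrite -(IH (ltnW lm)) -[RHS]DS; congr D; apply/val_inj => /=.
by rewrite modn_small.
Qed.
End CyclicOrder.

Section DeltaSums.
Variables (R : realType) (I : finType).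

Lemma sum_deltal (x : I -> R) j : \sum_i (i == j)%:R * x i = x j.
Proof.
rewrite (bigD1 j) //= eqxx mul1r big1 ?addr0 // => i ij.
by rewrite (negbTE ij) mul0r.
Qed.

Lemma sum_deltar (x : I -> R) j : \sum_i (j == i)%:R * x i = x j.
Proof. by rewrite -[RHS]sum_deltal; apply: eq_bigr => i _; rewrite eq_sym. Qed.

Lemma sum_delta1 (j : I) : \sum_i (i == j)%:R = 1 :> R.
Proof.
by rewrite -[RHS](sum_deltal (fun=> 1) j); apply: eq_bigr => i _; rewrite mulr1.
Qed.
End DeltaSums.

(* For [n >= 2] this is the Gram matrix of a simple cycle; for [n = 1] both
   off-diagonal terms coincide and it gives [-1], as for any segment. *)
Definition cycle_gram (R : realType) (n : nat) (i j : 'I_n.+1) : R :=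
  (i == j)%:R - ((j == ordS i)%:R + (i == ordS j)%:R) / 2.

(** The working form of [coxeter_simplex_A], see [coxeter_simplex_AP]; [s] lists the facets along
    the cycle. *)
Definition cyclic_normals (R : realType) (n : nat) (v : 'I_n.+1 -> 'rV[R]_n)
    (s : 'I_n.+1 -> 'I_n.+1) : Prop :=
  bijective s /\ forall i j,
    dot (outward_normal v (s i)) (outward_normal v (s j)) = cycle_gram R i j.

Section Alcove.
Variables (R : realType) (n : nat) (v : 'I_n.+1 -> 'rV[R]_n).
Variable s : 'I_n.+1 -> 'I_n.+1.
Hypotheses (hn : (0 < n)%N) (sv : is_simplex v) (sP : cyclic_normals v s).

Local Notation f := (outward_normal v).

Let s_inj : injective s.
Proof. by case: sP => /bij_inj. Qed.

Let s_surj i : exists j, i = s j.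
Proof. by case: sP => -[t _ tK] _; exists (t i); rewrite tK. Qed.

(** Each row of the Gram matrix sums to [1 - (1 + 1) / 2 = 0], so the sum has norm zero. *)
Lemma sum_cyclic_normals : \sum_k f (s k) = 0.
Proof.
apply: dot_eq0P; rewrite dot_suml big1 // => i _; rewrite dot_sumr.
rewrite (eq_bigr _ (fun j _ => sP.2 i j)) /cycle_gram sumrB -mulr_suml big_split /=.
rewrite !(eq_bigr (fun j => (j == ord_pred i)%:R : R) (P := predT)
  (F1 := fun j => (i == ordS j)%:R)); last first.
  by move=> j _; rewrite eq_ord_pred eq_sym.
rewrite !sum_delta1 (eq_bigr (fun j => (j == i)%:R : R)); last first.
  by move=> j _; rewrite eq_sym.
rewrite sum_delta1; lra.
Qed.

Definition alcove_size : R := height v (s ord0).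
Local Notation h := alcove_size.

Lemma alcove_size_gt0 : 0 < h. Proof. exact: height_gt0. Qed.

Lemma alcove_size_neq0 : h != 0. Proof. exact: height_neq0. Qed.

(** The relation with all weights 1 must be proportional to the one with weights [1 / height]. *)
Lemma heightE k : height v k = h.
Proof.
have := @normals_relation_unique _ _ _ hn sv (fun=> 1).
rewrite (reindex s) /=; last exact: onW_bij sP.1.
rewrite (eq_bigr (f \o s)); last by move=> i _; rewrite scale1r.
by move=> /(_ sum_cyclic_normals k (s ord0)); rewrite !mul1r.
Qed.

Definition alcove_bary k y := bary v (s k) y.
Local Notation lam := alcove_bary.

Lemma sum_lam y : \sum_k lam k y = 1.
Proof. by rewrite -(sum_bary hn sv y) [RHS](reindex s) //; exact: onW_bij sP.1. Qed.

Lemma lam_inj x y : (forall k, lam k x = lam k y) -> x = y.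
Proof.
move=> xy; apply: (bary_inj hn sv) => i; have [j ->] := s_surj i.
exact: xy.
Qed.

Lemma lam_add k x u : lam k (x + u) = lam k x - dot (f (s k)) u / h.
Proof. by rewrite /alcove_bary bary_addr // heightE. Qed.

Lemma cyclic_normals_span u : (forall k, dot (f (s k)) u = 0) -> u = 0.
Proof.
move=> fu; apply: (normals_span hn sv) => i; have [j ->] := s_surj i.
exact: fu.
Qed.

(* The weights [e_i] of the standard representation of the symmetric group:
   [E i - E j] are the roots. *)
Definition E i := v (s i) - v (s (ord_pred i)).

Lemma normal_dot_E k i : dot (f (s k)) (E i) = h * ((ordS k == i)%:R - (k == i)%:R).
Proof. by rewrite /E normal_dot_edge // heightE !(inj_eq s_inj) eq_ord_pred mulrC. Qed.

(** Both sides have the same product with every normal, and the normals span; this is where the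
    cyclic Gram matrix enters. *)
Lemma E_subS k : E k - E (ordS k) = (- (2 * h)) *: f (s k).
Proof.
apply/eqP; rewrite -subr_eq0; apply/eqP/cyclic_normals_span => m.
rewrite dotB (dotB _ (E k)) dotZr !normal_dot_E sP.2 /cycle_gram
  (inj_eq (@ordS_inj _)) (eq_sym k (ordS m)); by field.
Qed.

(** After subtraction of the diagonal term, the Gram matrix is unchanged by a cyclic shift of one
    index and is symmetric, hence constant. The value of [c] disappears from differences of the
    [E i]. *)
Lemma E_dot : exists c, forall i j, dot (E i) (E j) = 2 * h ^+ 2 * (i == j)%:R + c.
Proof.
pose D i k := dot (E i) (E k) - 2 * h ^+ 2 * (i == k)%:R.
have DS i k l : D i k = D i l.
  apply: ordS_invariant k l => k; apply/eqP; rewrite /D -subr_eq0.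
  have : dot (E i) (E k - E (ordS k)) = - (2 * h) * dot (f (s k)) (E i).
    by rewrite E_subS dotZr dotC.
  rewrite dotB normal_dot_E (eq_sym (ordS k)) (eq_sym k) => e; apply/eqP.
  by apply: oppr_inj; rewrite oppr0 !opprB; move/eqP: e;
    rewrite -subr_eq0 => /eqP <-; ring.
have DC i k : D i k = D k i by rewrite /D dotC eq_sym.
exists (D ord0 ord0) => i j; rewrite (DS _ _ i) DC (DS _ _ j) /D; ring.
Qed.

Lemma E_dotB p i j : dot (E p) (E i - E j) = 2 * h ^+ 2 * ((p == i)%:R - (p == j)%:R).
Proof. have [c Ec] := E_dot; rewrite dotB !Ec; ring. Qed.

Lemma E_neq0 p : E p != 0.
Proof.
apply/eqP => E0; have := normal_dot_E p p;
  rewrite E0 dot0r eqxx (negbTE (ordS_neq hn p)) sub0r mulrN1.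
by move/eqP; rewrite eq_sym oppr_eq0 (negbTE alcove_size_neq0).
Qed.

Lemma sum_E : \sum_i E i = 0.
Proof.
rewrite /E sumrB [X in X - _](reindex (@ord_pred n.+1)) ?subrr //.
by apply: onW_bij; exists (@ordS n.+1); [exact: ord_predK|exact: ordSK].
Qed.

(* The affine coordinates on which the affine Weyl group acts by permutations
   and integral translations. *)
Definition coordA i y : R := dot (E i) (y - v (s ord_max)) / (2 * h ^+ 2).

(** The left sides sum to 0 around the cycle while the [lam k] sum to 1; the base point
    [v (s ord_max)] of [coordA] puts the whole defect at [ord_max]. *)
Lemma coordA_subS k y : coordA k y - coordA (ordS k) y = lam k y - (k == ord_max)%:R.
Proof.
have -> : lam k y = lam k (v (s ord_max)) - dot (f (s k)) (y - v (s ord_max)) / h.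
  by rewrite -lam_add addrCA subrr addr0.
rewrite /alcove_bary bary_vertex // (inj_eq s_inj) addrAC subrr sub0r.
rewrite /coordA -mulrBl -dotBl E_subS dotZl; field; exact: alcove_size_neq0.
Qed.

Lemma coordA_inj x y : (forall i, coordA i x = coordA i y) -> x = y.
Proof.
move=> xy; apply: lam_inj => k; apply: (addIr (- (k == ord_max)%:R)).
by rewrite -!coordA_subS !xy.
Qed.

Definition wall_reflection k := reflection (f (s k)) (dot (f (s k)) (v (ordS (s k)))).

Lemma wall_reflectionE k y : wall_reflection k y = y + (2 * h * lam k y) *: f (s k).
Proof.
rewrite /wall_reflection /reflection normal_dot1 // divr1 -scaleNr; congr (_ + _ *: _).
rewrite /alcove_bary /bary heightE dotB; field; exact: alcove_size_neq0.
Qed.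

Lemma coordA_wall_reflection k i y : coordA i (wall_reflection k y) =
  coordA i y + lam k y * ((ordS k == i)%:R - (k == i)%:R).
Proof.
rewrite /coordA wall_reflectionE addrAC dotDr dotZr dotC (dotC (E i) (f (s k)))
  normal_dot_E.
rewrite (dotC _ (E i)); field; exact: alcove_size_neq0.
Qed.
End Alcove.

(* If every normal is a root [E a - E b], the positive relation between the
   normals makes both [a] and [b] surjective, hence bijective; the permutation
   taking [a k] to [b k] is a single cycle because no proper subfamily of
   normals is dependent. *)
Lemma root_normals_cyclic (R : realType) (n : nat) (v w : 'I_n.+1 -> 'rV[R]_n)
    (s : 'I_n.+1 -> 'I_n.+1) :
  (0 < n)%N -> is_simplex v -> cyclic_normals v s -> is_simplex w ->
  (forall k, exists c i j, i != j /\
     outward_normal w k = c *: (E v s i - E v s j)) ->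
  exists t, cyclic_normals w t.
Proof.
move=> hn sv sP sw roots; set h := alcove_size v s.
have h0 : 0 < h by exact: alcove_size_gt0.
have hN0 : h != 0 by rewrite gt_eqF.
pose g k := outward_normal w k.
have Ed := E_dotB hn sv sP.
have E2 i j : i != j -> dot (E v s i - E v s j) (E v s i - E v s j) = 4 * h ^+ 2.
  move=> ij; rewrite dotBl !Ed !eqxx (negbTE ij) (eq_sym j) (negbTE ij) -/h /=; ring.
(* Roots have length [2 * h], so the scalar is [1 / (2 * h)] up to a sign, which swapping the pair
   absorbs. *)
have /choice[p pP] : forall k, exists p : 'I_n.+1 * 'I_n.+1,
    p.1 != p.2 /\ g k = (2 * h)^-1 *: (E v s p.1 - E v s p.2).
  move=> k; have [c [i [j [ij gE]]]] := roots k.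
  have := normal_dot1 hn sw k; rewrite gE dotZ E2 // => c1.
  have /eqP : (c * (2 * h)) ^+ 2 = 1 by rewrite -[RHS]c1; ring.
  rewrite sqrf_eq1 => /orP[]/eqP ch.
  - exists (i, j); split => //; rewrite /g gE; congr (_ *: _).
    by apply: (mulIf (x := 2 * h)); rewrite ?mulVf // mulf_neq0.
  - exists (j, i); split => /=; first by rewrite eq_sym.
    rewrite /g gE -opprB scalerN -scaleNr; congr (_ *: _).
    by apply: (mulIf (x := 2 * h)); rewrite ?mulNr ?ch ?opprK ?mulVf // mulf_neq0.
pose a k := (p k).1; pose b k := (p k).2.
have gE k : g k = (2 * h)^-1 *: (E v s (a k) - E v s (b k)) by case: (pP k).
have dotgE q k : dot (E v s q) (g k) = h * ((q == a k)%:R - (q == b k)%:R).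
  by rewrite gE dotZr Ed -/h; field.
pose c k := (height w k)^-1.
have c0 k : 0 < c k by rewrite invr_gt0 height_gt0.
have bal q : \sum_k c k * (q == a k)%:R = \sum_k c k * (q == b k)%:R.
  have : dot (E v s q) (\sum_k c k *: g k) = 0 by rewrite normals_relation // dot0r.
  rewrite dot_sumr (eq_bigr (fun k => h * (c k * (q == a k)%:R - c k * (q == b k)%:R))).
    by rewrite -mulr_sumr sumrB => /eqP; rewrite mulf_eq0 (negbTE hN0) subr_eq0 => /eqP.
  by move=> k _; rewrite dotZr dotgE; ring.
(* The weights are positive: an index missed by one end of all arrows has total weight zero and is
   missed by the other end too, which [nosolo] excludes. *)
have touch (d e : 'I_n.+1 -> 'I_n.+1) q :
    \sum_k c k * (q == d k)%:R = \sum_k c k * (q == e k)%:R ->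
    (forall k, q != d k) -> forall k, q != e k.
  move=> de qd k; apply/negP => qe; move: de; rewrite big1 => [/eqP|i _]; last first.
    by rewrite (negbTE (qd i)) mulr0.
  rewrite eq_sym psumr_eq0 => [/allP/(_ k (mem_index_enum _))|i _]; last first.
    by rewrite mulr_ge0 // ltW.
  by rewrite qe mulr1 gt_eqF.
have nosolo q : ~ ((forall k, q != a k) /\ (forall k, q != b k)).
  case=> qa qb; have /eqP := E_neq0 hn sv sP q; apply; apply: (normals_span hn sw) => k.
  by rewrite dotC -/(g k) dotgE (negbTE (qa k)) (negbTE (qb k)) subrr mulr0.
have bij (d : 'I_n.+1 -> 'I_n.+1) : (forall q, exists k, d k = q) ->
    exists2 t, cancel t d & cancel d t.
  case/choice=> t td; exists t => //; have tb := injF_bij (can_inj td).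
  by case: tb => r tr rt i; have := rt i => <-; rewrite td.
have [ta taK aK] : exists2 t, cancel t a & cancel a t.
  apply: bij => q; apply: contrapT => /forallNP qa.
  have qa' k : q != a k by apply/eqP => e; exact: (qa k).
  by apply: (nosolo q); split => //; exact: touch (bal q) qa'.
have [tb tbK bK] : exists2 t, cancel t b & cancel b t.
  apply: bij => q; apply: contrapT => /forallNP qb.
  have qb' k : q != b k by apply/eqP => e; exact: (qb k).
  by apply: (nosolo q); split => //; exact: touch (esym (bal q)) qb'.
pose r k := ta (b k).
have ar k : a (r k) = b k by rewrite /r taK.
have r_inj : injective r by move=> i j /(can_inj taK)/(can_inj bK).
(* The normals indexed by one orbit of [r] telescope to zero because [a (r k) = b k]; uniqueness of
   the relation forces the orbit to be everything. *)
have full k : fconnect r ord0 k.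
  pose x k : R := (fconnect r ord0 k)%:R.
  have xr i : x (r i) = x i.
    rewrite /x; congr (_%:R); apply/esym; apply: congr1.
    exact: (same_connect_r (fconnect_sym r_inj) (fconnect1 r i)).
  have x0 : \sum_i x i *: g i = 0.
    rewrite (eq_bigr (fun i => (2 * h)^-1 *: (x i *: E v s (a i)) -
      (2 * h)^-1 *: (x (r i) *: E v s (a (r i))))).
      by rewrite sumrB [X in X - _](reindex_inj r_inj) subrr.
    by move=> i _; rewrite xr ar gE -!scalerBr !scalerA mulrC.
  have := normals_relation_unique hn sw x0 k ord0.
  rewrite /x connect0 mul1r; case: (fconnect r ord0 k) => //; rewrite mul0r => /eqP.
  by rewrite eq_sym (negbTE (height_neq0 hn sw _)).
have ord_r : order r ord0 = n.+1.
  by rewrite /order -[RHS](card_ord n.+1); apply: eq_card => i; rewrite !inE full.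
pose t (i : 'I_n.+1) := iter i r ord0.
have t_inj : injective t.
  move=> i j tij; apply/val_inj => /=.
  by rewrite -(@findex_iter _ r ord0 i) ?ord_r // -/(t i) tij findex_iter // ord_r.
have tS i : t (ordS i) = r (t i).
  have := ltn_ord i; rewrite ltnS leq_eqVlt => /orP[/eqP ie|li].
    by rewrite (ordS_max ie) /t -iterS ie; have := iter_order r_inj ord0; rewrite ord_r.
  by rewrite /t ordS_val.
exists t; split; first exact: injF_bij.
move=> i j; rewrite -/(g (t i)) -/(g (t j)) {1}gE dotZl dotBl !dotgE.
rewrite -!ar -!tS !(can_eq aK) !(inj_eq t_inj) /cycle_gram (inj_eq (@ordS_inj _)).
by rewrite (eq_sym (ordS i)); field.
Qed.

(** * Gram matrix versus dihedral angles *)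

Section CoxeterSimplexA.
Variables (R : realType) (n : nat).
Implicit Type v : 'I_n.+1 -> 'rV[R]_n.

(** The triple angle formula at [cos pi = -1] gives [(c + 1) * (2 * c - 1) ^+ 2 = 0], and [c] is
    positive. *)
Lemma cos_pi3 : cos (pi / 3) = 1 / 2 :> R.
Proof.
have p0 := pi_gt0 R.
have c0 : 0 < cos (pi / 3 : R) by apply: cos_gt0_pihalf; apply/andP; split; lra.
set t : R := pi / 3 in c0 *.
have e : cos (t + t + t) = -1 by rewrite -[RHS]cospi; congr cos; rewrite /t; field.
have := e; rewrite cosD cosD sinD.
have := cos2Dsin2 t; set c := cos t in c0 *; set z := sin t => cz ce.
have z2 : z * z = 1 - c * c by rewrite -!expr2; lra.
have /eqP : (c + 1) * (2 * c - 1) ^+ 2 = 0.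
  have -> : (c + 1) * (2 * c - 1) ^+ 2 = 4 * c * c * c - 3 * c + 1 by ring.
  have : (c * c - z * z) * c - (z * c + c * z) * z = c * c * c - 3 * c * (z * z) by ring.
  rewrite ce z2 => h; have -> : 4 * c * c * c - 3 * c + 1 = c * c * c - 3 * c *
    (1 - c * c) + 1 by ring.
  by rewrite -h; ring.
rewrite mulf_eq0 expf_eq0 /= => /orP[/eqP h|/eqP h]; lra.
Qed.

Lemma pi_sub_acos_edge (b : bool) : pi - acos (- (b%:R / 2) : R) = pi / (b + 2)%:R.
Proof.
case: b; rewrite /= ?mul0r ?oppr0; last by rewrite acos0 /=; field.
have p0 := pi_gt0 R.
have -> : - (1 / 2) = cos (pi - pi / 3) :> R.
  by rewrite addrC cosDpi cosN cos_pi3.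
rewrite cosK ?in_itv /=; first by field.
by apply/andP; split; lra.
Qed.

(** Injectivity of [acos] holds on [[-1, 1]], where [unit_dot_itv] places the product of two unit
    normals. *)
Lemma dihedral_angle_edgeP v i j (b : bool) : (0 < n)%N -> is_simplex v ->
  dihedral_angle v i j = pi / (b + 2)%:R <->
  dot (outward_normal v i) (outward_normal v j) = - (b%:R / 2).
Proof.
move=> hn sv; rewrite /dihedral_angle -pi_sub_acos_edge; split=>
  [/addrI/oppr_inj e|-> //].
have B := unit_dot_itv (normal_dot1 hn sv i) (normal_dot1 hn sv j).
rewrite -[LHS]acosK ?in_itv //= e acosK // in_itv /=.
by apply/andP; split; case: (b) => /=; lra.
Qed.

Lemma ordSS_neq (i : 'I_n.+1) : (1 < n)%N -> ordS (ordS i) != i.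
Proof.
move=> n1; apply/eqP => /(congr1 val) e.
have := ltn_ord i; rewrite ltnS leq_eqVlt => /orP[/eqP ie|li].
  by move: e; rewrite (ordS_max ie) /= modn_small ?ie; move: n1; case: n => [|[|m]].
have := ltn_ord (ordS i); rewrite ltnS leq_eqVlt => /orP[/eqP ie|lSi].
  by move: e; rewrite (ordS_max ie) => e0; move: ie; rewrite ordS_val // -e0 => n0;
    move: n1; rewrite -n0.
move: e; rewrite [val _]ordS_val // ordS_val // => /eqP.
by rewrite -[X in _ == X]addn0 -addn2 eqn_add2l.
Qed.

(** With at least three nodes the successor and the predecessor of a node differ, so the two terms
    of [cycle_gram] never add up. *)
Lemma cycle_gram_edge (i j : 'I_n.+1) : (1 < n)%N -> i != j ->
  cycle_gram R i j = - (((j == ordS i) || (i == ordS j))%:R / 2).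
Proof.
move=> n1 ij; rewrite /cycle_gram (negbTE ij) sub0r.
have [->|_] := eqVneq j (ordS i); last by case: (_ == _); rewrite /= ?add0r.
by rewrite eq_sym (negbTE (ordSS_neq i n1)) addr0.
Qed.

(** Two unit vectors with a positive linear relation are opposite. *)
Lemma segment_cyclic_normals v : n = 1%N -> is_simplex v -> cyclic_normals v id.
Proof.
move=> n1 sv; have hn : (0 < n)%N by rewrite n1.
split; first by exists id.
subst n; have := normals_relation hn sv; rewrite big_ord_recl big_ord1.
set f0 := outward_normal v ord0; set j := lift _ _; set f1 := outward_normal v j.
set c0 := (height v ord0)^-1; set c1 := (height v j)^-1 => rel.
have c0_gt0 : 0 < c0 by rewrite invr_gt0 height_gt0.
have c1_gt0 : 0 < c1 by rewrite invr_gt0 height_gt0.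
have d0 : dot f0 f0 = 1 by exact: normal_dot1.
have d1 : dot f1 f1 = 1 by exact: normal_dot1.
have r0 : dot f0 (c0 *: f0 + c1 *: f1) = 0 by rewrite rel dot0r.
have r1 : dot f1 (c0 *: f0 + c1 *: f1) = 0 by rewrite rel dot0r.
move: r0 r1; rewrite !dotDr !dotZr d0 d1 (dotC f1 f0) !mulr1 => r0 r1.
have x : dot f0 f1 = -1.
  have h : (c0 - c1) * (1 - dot f0 f1) = 0 by lra.
  have : dot f0 f1 < 0 by rewrite -(pmulr_rlt0 _ c0_gt0); lra.
  move/eqP: h; rewrite mulf_eq0 => /orP[]/eqP h h'; last by lra.
  apply: (mulfI (lt0r_neq0 c0_gt0)); lra.
move=> i k.
have E (l : 'I_2) : l = ord0 \/ l = j.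
  by case: l => -[|[|//]] p; [left|right]; apply/val_inj.
have S0 : ordS (ord0 : 'I_2) = j by apply/val_inj.
have S1 : ordS j = ord0 by apply/val_inj.
have j0 : (j == ord0) = false by [].
have j0' : (ord0 == j) = false by [].
have x' : dot f1 f0 = -1 by rewrite dotC.
by case: (E i) => ->; case: (E k) => ->; rewrite /cycle_gram -/f0 -/f1
  !(d0, d1, x, x', S0, S1, j0, j0', eqxx) /=; lra.
Qed.

Lemma coxeter_simplex_AP v : (0 < n)%N ->
  coxeter_simplex_A v <-> is_simplex v /\ exists s, cyclic_normals v s.
Proof.
move=> hn; rewrite /coxeter_simplex_A; have [n1|n1] := eqVneq n 1%N.
  split=> [sv|[]//]; split=> //; exists id; exact: segment_cyclic_normals.
have {}n1 : (1 < n)%N by rewrite ltn_neqAle eq_sym n1.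
split=> [[[sv _] [m dm [s sb sm]]]|[sv [s [sb sg]]]].
- split=> //; exists s; split=> // i j; have [->|ij] := eqVneq i j.
    by rewrite normal_dot1 // /cycle_gram eqxx eq_sym (negbTE (ordS_neq hn j)) /=; lra.
  rewrite cycle_gram_edge //; apply/dihedral_angle_edgeP => //.
  by rewrite dm ?sm // (inj_eq (bij_inj sb)).
- case: (sb) => t sK tK.
  pose b i j := (t j == ordS (t i)) || (t i == ordS (t j)).
  have bP i j : i != j -> dihedral_angle v i j = pi / (b i j + 2)%:R.
    move=> ij; apply/dihedral_angle_edgeP => //.
    by rewrite -{1}(tK i) -{1}(tK j) sg cycle_gram_edge // (inj_eq (can_inj tK)).
  split; first by split=> // i j ij; exists (b i j + 2)%N; rewrite ?addn2 ?bP // addn2.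
  exists (fun i j => nat_of_bool (b i j)) => //.
  by exists s => // i j ij; rewrite /b !sK.
Qed.
End CoxeterSimplexA.

(** * Similarities and families *)

Section Similarity.
Variables (R : realType) (n : nat) (phi : 'rV[R]_n -> 'rV[R]_n) (k : R).
Hypotheses (hn : (0 < n)%N) (k0 : 0 < k).
Hypothesis phiP : forall x y, enorm (phi x - phi y) = k * enorm (x - y).

Let psi x := phi x - phi 0.

Let psi_dot x y : dot (psi x) (psi y) = k ^+ 2 * dot x y.
Proof.
have sq u w : dot (phi u - phi w) (phi u - phi w) = k ^+ 2 * dot (u - w) (u - w).
  by rewrite -!sqr_enorm phiP exprMn.
have := sq x y; have := sq x 0; have := sq y 0; rewrite !subr0 -/(psi x) -/(psi y).
have -> : phi x - phi y = psi x - psi y by rewrite /psi opprB addrA subrK.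
move=> hy hx; rewrite !(dotBl (psi x)) !(dotB _ (psi x)) hx hy (dotC (psi y)).
rewrite !(dotBl x) !(dotB _ x) (dotC y x) => hxy; lra.
Qed.

(** The squared norm of the defect expands into inner products, all multiplied by [k ^+ 2] under
    [psi], so it equals that of [x + y - x - y], up to this factor. *)
Let psiD x y : psi (x + y) = psi x + psi y.
Proof.
apply/eqP; rewrite -subr_eq0 opprD addrA; apply/eqP/dot_eq0P.
have expand (u a b : 'rV[R]_n) : dot (u - a - b) (u - a - b) =
    dot u u + dot a a + dot b b - 2 * dot u a - 2 * dot u b + 2 * dot a b.
  by rewrite !(dotDl, dotDr, dotNl, dotNr) (dotC a u) (dotC b u) (dotC b a); ring.
by rewrite expand !psi_dot !(dotDl, dotDr) (dotC y x); ring.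
Qed.

Let psiZ c x : psi (c *: x) = c *: psi x.
Proof.
apply/eqP; rewrite -subr_eq0; apply/eqP/dot_eq0P.
have expand (u a : 'rV[R]_n) : dot (u - c *: a) (u - c *: a) =
    dot u u - 2 * c * dot u a + c ^+ 2 * dot a a.
  by rewrite !(dotDl, dotDr, dotNl, dotNr, dotZl, dotZr) (dotC a u); ring.
by rewrite expand !psi_dot !dotZl !dotZr; ring.
Qed.

Let psi_sum (c : 'I_n.+1 -> R) (u : 'I_n.+1 -> 'rV[R]_n) :
  psi (\sum_i c i *: u i) = \sum_i c i *: psi (u i).
Proof.
have psi0 : psi 0 = 0 by rewrite /psi subrr.
by rewrite (big_morph psi psiD psi0); apply: eq_bigr => i _; rewrite psiZ.
Qed.

Let psi_inj0 x : psi x = 0 -> x = 0.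
Proof.
move=> px; apply: dot_eq0P; have := psi_dot x x; rewrite px dot0r => /esym/eqP.
by rewrite mulf_eq0 expf_eq0 gt_eqF //= => /eqP.
Qed.

Let psiB x y : phi x - phi y = psi (x - y).
Proof. by rewrite -[- y]scaleN1r psiD psiZ scaleN1r /psi opprB addrA subrK. Qed.

Lemma similarity_simplex v : is_simplex (phi \o v) <-> is_simplex v.
Proof.
have comb c : \sum_i c i = 0 -> \sum_i c i *: (phi \o v) i = psi (\sum_i c i *: v i).
  move=> c0; rewrite psi_sum (eq_bigr (fun i => c i *: psi (v i) + c i *: phi 0)).
    by rewrite big_split /= -scaler_suml c0 scale0r addr0.
  by move=> i _; rewrite -scalerDr /psi subrK.
split=> sv c c0 cv; apply: sv => //.
- by rewrite comb // cv /psi subrr.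
- by apply: psi_inj0; rewrite -comb.
Qed.

Lemma similarity_normal v i : is_simplex v ->
  outward_normal (phi \o v) i = k^-1 *: (phi (outward_normal v i) - phi 0).
Proof.
move=> sv; apply/esym/outward_normal_unique => //; first exact/similarity_simplex.
rewrite -/(psi _); have kN0 : k != 0 by rewrite gt_eqF.
case: (outward_normalP i hn sv) => _ f0 fn.
split=> [|j l ji li|j ji] /=.
- rewrite /enorm dotZ psi_dot normal_dot1 // mulr1 (_ : _ * _ = 1) ?sqrtr1 //.
  by field.
- by rewrite dotZl psiB psi_dot f0 // !mulr0.
- rewrite dotZl psiB psi_dot expr2 !mulrA mulVf // mul1r pmulr_rlt0 //; exact: fn.
Qed.

Lemma similarity_normal_dot v i j : is_simplex v ->
  dot (outward_normal (phi \o v) i) (outward_normal (phi \o v) j) =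
  dot (outward_normal v i) (outward_normal v j).
Proof.
move=> sv; rewrite !similarity_normal // dotZ -!/(psi _) psi_dot.
by field; rewrite gt_eqF.
Qed.
End Similarity.

Lemma cyclic_normals_similarity (R : realType) (n : nat)
    (phi : 'rV[R]_n -> 'rV[R]_n) (v : 'I_n.+1 -> 'rV[R]_n) s :
  (0 < n)%N -> similarity phi -> is_simplex v ->
  cyclic_normals (phi \o v) s -> cyclic_normals v s.
Proof.
move=> hn [k k0 phiP] sv [sb sg]; split=> // i j.
by rewrite -(similarity_normal_dot hn k0 phiP).
Qed.

(** * Isometries between alcoves and uniqueness of the family *)

Section AlcoveIsometry.
Variables (R : realType) (n : nat).
Hypothesis hn : (0 < n)%N.
Implicit Types v : 'I_n.+1 -> 'rV[R]_n.

(** By [E_frame], [u] has coefficients [dot (E i) u / (2 * h ^+ 2)] on the [E i]. The map sends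
    [E i / h] to [E' i / h']; these systems have equal Gram matrices. *)
Definition alcove_map v s v' s' (u : 'rV[R]_n) : 'rV[R]_n :=
  \sum_i (dot (E v s i) u / (2 * alcove_size v s * alcove_size v' s')) *: E v' s' i.

Lemma E_frame v s u : is_simplex v -> cyclic_normals v s ->
  \sum_i dot (E v s i) u *: E v s i = (2 * alcove_size v s ^+ 2) *: u.
Proof.
move=> sv sP; apply/eqP; rewrite -subr_eq0; apply/eqP.
apply: (cyclic_normals_span hn sv sP) => k.
rewrite dotB dot_sumr dotZr (eq_bigr (fun i => alcove_size v s *
  ((ordS k == i)%:R * dot (E v s i) u - (k == i)%:R * dot (E v s i) u))); last first.
  by move=> i _; rewrite dotZr normal_dot_E //; ring.
rewrite -mulr_sumr sumrB !sum_deltar -dotBl -(opprB (E v s k)) dotNl E_subS // dotZl;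
  ring.
Qed.

Lemma alcove_mapB v s v' s' x y :
  alcove_map v s v' s' (x - y) = alcove_map v s v' s' x - alcove_map v s v' s' y.
Proof.
rewrite /alcove_map -sumrB; apply: eq_bigr => i _.
by rewrite -scalerBl dotB mulrBl.
Qed.

Section Pair.
Variables (v v' : 'I_n.+1 -> 'rV[R]_n) (s s' : 'I_n.+1 -> 'I_n.+1).
Hypotheses (sv : is_simplex v) (sP : cyclic_normals v s).
Hypotheses (sv' : is_simplex v') (sP' : cyclic_normals v' s').
Local Notation h := (alcove_size v s).
Local Notation h' := (alcove_size v' s').

Let h0 : h != 0. Proof. exact: alcove_size_neq0. Qed.
Let h0' : h' != 0. Proof. exact: alcove_size_neq0. Qed.

Lemma E_dot_alcove_map j u :
  dot (E v' s' j) (alcove_map v s v' s' u) = h' / h * dot (E v s j) u.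
Proof.
have [c Ec] := E_dot hn sv' sP'.
rewrite dot_sumr (eq_bigr (fun i => h' / h * ((j == i)%:R * dot (E v s i) u) +
  c / (2 * h * h') * dot (E v s i) u)); last first.
  by move=> i _; rewrite dotZr Ec; field; rewrite h0 h0'.
rewrite big_split /= -!mulr_sumr sum_deltar -dot_suml sum_E //.
by rewrite dot0l mulr0 addr0.
Qed.

Lemma alcove_mapK : cancel (alcove_map v s v' s') (alcove_map v' s' v s).
Proof.
move=> u; rewrite /alcove_map -/(alcove_map v s v' s' u).
rewrite (eq_bigr (fun i => (2 * h ^+ 2)^-1 *: (dot (E v s i) u *: E v s i)));
  last first.
  by move=> i _; rewrite E_dot_alcove_map scalerA; congr (_ *: _); field;
    rewrite h0 h0'.
rewrite -scaler_sumr E_frame // scalerA mulVf ?scale1r //.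
by rewrite mulf_neq0 // expf_neq0.
Qed.

Lemma alcove_map_dot x y :
  dot (alcove_map v s v' s' x) (alcove_map v s v' s' y) = dot x y.
Proof.
rewrite {1}/alcove_map dot_suml.
rewrite (eq_bigr (fun i => (2 * h ^+ 2)^-1 * dot (dot (E v s i) x *: E v s i) y));
  last first.
  by move=> i _; rewrite !dotZl E_dot_alcove_map; field; rewrite h0 h0'.
rewrite -mulr_sumr -dot_suml E_frame // dotZl mulrA mulVf ?mul1r //.
by rewrite mulf_neq0 // expf_neq0.
Qed.

Lemma alcove_map_isometry x y :
  enorm (alcove_map v s v' s' x - alcove_map v s v' s' y) = 1 * enorm (x - y).
Proof. by rewrite mul1r -alcove_mapB /enorm alcove_map_dot. Qed.

Lemma alcove_map_normal k :
  alcove_map v s v' s' (outward_normal v (s k)) = outward_normal v' (s' k).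
Proof.
apply/eqP; rewrite -subr_eq0; apply/eqP/(cyclic_normals_span hn sv' sP') => j.
apply: (mulfI (x := - (2 * h'))).
  by rewrite oppr_eq0 mulf_neq0.
rewrite mulr0 -dotZl -E_subS // dotB dotBl !E_dot_alcove_map -mulrBr -dotBl.
rewrite !E_subS // !dotZl sP.2 sP'.2; field; exact: h0.
Qed.

Lemma alcove_map_normals (w : 'I_n.+1 -> 'rV[R]_n) : is_simplex w ->
  facet_normals (alcove_map v s v' s' \o w) = alcove_map v s v' s' @` facet_normals w.
Proof.
move=> sw; set psi := alcove_map _ _ _ _.
have N i : outward_normal (psi \o w) i = psi (outward_normal w i).
  rewrite (similarity_normal hn ltr01 alcove_map_isometry) // invr1 scale1r.
  by rewrite -alcove_mapB subr0.
have psiN x : psi (- x) = - psi x.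
  by rewrite -sub0r /psi alcove_mapB -[X in _ X - _](subrr 0) alcove_mapB subrr sub0r.
apply/seteqP; split=> [x [i]|_ [x [i +] <-]].
- by rewrite N => -[->|->]; [exists (outward_normal w i)|exists (- outward_normal w i)] => //;
    exists i; [left|right].
- by move=> xE; exists i; rewrite N -psiN; case: xE => ->; [left|right].
Qed.

Lemma alcove_map_facet_normals :
  alcove_map v s v' s' @` facet_normals v = facet_normals v'.
Proof.
have [[t _ tK] _] := sP; have [[t' _ tK'] _] := sP'.
rewrite -alcove_map_normals //; apply/seteqP; split=> x [i].
- rewrite (similarity_normal hn ltr01 alcove_map_isometry) // invr1 scale1r.
  rewrite -alcove_mapB subr0 -(tK i) alcove_map_normal => xE.
  by exists (s' (t i)).
- rewrite -(tK' i) -alcove_map_normal => xE; exists (s (t' i)).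
  rewrite (similarity_normal hn ltr01 alcove_map_isometry) // invr1 scale1r.
  by rewrite -alcove_mapB subr0.
Qed.

Lemma alcove_map_family w : Defs.family v w -> Defs.family v' (alcove_map v s v' s' \o w).
Proof.
case=> sw wv; split; first exact/(similarity_simplex ltr01 alcove_map_isometry).
by rewrite alcove_map_normals // wv alcove_map_facet_normals.
Qed.
End Pair.

Lemma alcove_families_similar v s v' s' :
  is_simplex v -> cyclic_normals v s -> is_simplex v' -> cyclic_normals v' s' ->
  similar_families (Defs.family v) (Defs.family v').
Proof.
move=> sv sP sv' sP'; exists (alcove_map v s v' s').
  by exists 1; [exact: ltr01|exact: alcove_map_isometry].
apply/seteqP; split=> [w vw|_ [w vw <-]]; last exact: alcove_map_family.
exists (alcove_map v' s' v s \o w); first exact: alcove_map_family vw.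
by apply/funext => i /=; rewrite alcove_mapK.
Qed.

(** A sign change keeps a normal proportional to a root, so [root_normals_cyclic] applies to every
    member of the family, whatever the signs. *)
Lemma family_cyclic_normals v s w : is_simplex v -> cyclic_normals v s ->
  Defs.family v w -> exists t, cyclic_normals w t.
Proof.
move=> sv sP [sw wv]; apply: (root_normals_cyclic hn sv sP sw) => k.
have : facet_normals w (outward_normal w k) by exists k; left.
rewrite wv => -[i]; have [[t _ tK] _] := sP; rewrite -(tK i); set j := t i => fE.
have h0 : alcove_size v s != 0 by exact: alcove_size_neq0.
have NE : outward_normal v (s j) = (- (2 * alcove_size v s))^-1 *: (E v s j - E v s (ordS j)).
  rewrite E_subS // scalerA mulVf ?scale1r //.
  by rewrite oppr_eq0 mulf_neq0.
have jS : j != ordS j by rewrite eq_sym ordS_neq.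
case: fE => ->; rewrite NE; first by eexists; exists j, (ordS j); split.
by rewrite -scaleNr; eexists; exists j, (ordS j); split.
Qed.
End AlcoveIsometry.

(** * Existence of the simplex *)

(* The vectors [e_1, ..., e_n] together with [t (1, ..., 1)] have all mutual
   distances [sqrt 2] when [n t ^ 2 - 2 t - 1 = 0], so that their differences
   form a root system of type A. *)
Lemma equidistant_points (R : realType) (n : nat) : (0 < n)%N ->
  exists e : 'I_n.+1 -> 'rV[R]_n, forall a b c d,
    dot (e a - e b) (e c - e d) =
    (a == c)%:R - (a == d)%:R - (b == c)%:R + (b == d)%:R.
Proof.
move=> hn; pose q : R := Num.sqrt (1 + n%:R); pose t : R := (1 + q) / n%:R.
have n0 : n%:R != 0 :> R by rewrite pnatr_eq0 -lt0n.
have q2 : q ^+ 2 = 1 + n%:R by rewrite sqr_sqrtr // addr_ge0 // ler0n.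
have tE : n%:R * t ^+ 2 - 2 * t - 1 = 0.
  have -> : n%:R * t ^+ 2 - 2 * t - 1 = (q ^+ 2 - 1 - n%:R) / n%:R by rewrite /t; field.
  by rewrite q2; field.
pose e (i : 'I_n.+1) : 'rV[R]_n :=
  if (i < n)%N then \row_j ((j : nat) == i)%:R else const_mx t.
have dist i j : dot (e i) (e i) + dot (e j) (e j) - 2 * dot (e i) (e j) = 2 - 2 * (i == j)%:R.
  have ll (k l : 'I_n.+1) : (k < n)%N -> (l < n)%N -> dot (e k) (e l) = (k == l)%:R.
    move=> kn ln; rewrite /dot /e kn ln (bigD1 (Ordinal kn)) //=
      !mxE eqxx mul1r big1 ?addr0 //.
    by move=> m mk; rewrite !mxE -[X in (X == _)]/(val m)
      -[X in (_ == X)]/(val (Ordinal kn)) val_eqE (negbTE mk) mul0r.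
  have lm (k l : 'I_n.+1) : (k < n)%N -> (l < n)%N = false -> dot (e k) (e l) = t.
    move=> kn ln; rewrite /dot /e kn ln (bigD1 (Ordinal kn)) //=
      !mxE eqxx mul1r big1 ?addr0 //.
    by move=> m mk; rewrite !mxE -[X in (X == _)]/(val m)
      -[X in (_ == X)]/(val (Ordinal kn)) val_eqE (negbTE mk) mul0r.
  have mm (k l : 'I_n.+1) : (k < n)%N = false -> (l < n)%N = false ->
      dot (e k) (e l) = n%:R * t ^+ 2.
    move=> kn ln; rewrite /dot /e kn ln (eq_bigr (fun=> t ^+ 2)) => [|m _];
      last by rewrite !mxE.
    by rewrite sumr_const card_ord mulr_natl.
  case kn: (i < n)%N; case ln: (j < n)%N.
  - by rewrite !ll // !eqxx /=; ring.
  - have -> : (i == j) = false by apply/eqP => ij; rewrite ij ln in kn.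
    by rewrite (ll i i) // (lm i j) // (mm j j) // eqxx /=; lra.
  - have -> : (i == j) = false by apply/eqP => ij; rewrite ij ln in kn.
    by rewrite (dotC (e i)) (ll j j) // (lm j i) // (mm i i) // eqxx /=; lra.
  - have -> : i = j.
      apply/val_inj/eqP; rewrite eqn_leq; have := ltn_ord i; have := ltn_ord j.
      by move: kn ln => /negbT + /negbT; rewrite -!leqNgt !ltnS => a b c d;
        rewrite (leq_trans d b) (leq_trans c a).
    by rewrite eqxx /=; ring.
exists e => a b c d; rewrite !(dotBl (e a)) !(dotB _ (e c)).
by have := dist a c; have := dist a d; have := dist b c; have := dist b d; lra.
Qed.

Lemma exists_cyclic_normals (R : realType) (n : nat) : (0 < n)%N ->
  exists2 v : 'I_n.+1 -> 'rV[R]_n, is_simplex v & exists s, cyclic_normals v s.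
Proof.
move=> hn; have [e eP] := equidistant_points R hn.
pose r : R := (Num.sqrt 2)^-1.
have r0 : 0 < r by rewrite invr_gt0 sqrtr_gt0.
have r2 : r ^+ 2 = 1 / 2 by rewrite exprVn sqr_sqrtr // mul1r.
pose m : 'rV[R]_n := n.+1%:R^-1 *: \sum_l e l.
have N0 : n.+1%:R != 0 :> R by rewrite pnatr_eq0.
have em k k' j : dot (e k - e k') (e j - m) = (k == j)%:R - (k' == j)%:R.
  have -> : e j - m = n.+1%:R^-1 *: \sum_l (e j - e l).
    rewrite sumrB scalerBr sumr_const card_ord -[e j *+ _]scaler_nat scalerA mulVf //.
    by rewrite scale1r.
  rewrite dotZr dot_sumr (eq_bigr (fun l => (k == j)%:R - (k' == j)%:R +
    ((k' == l)%:R * 1 - (k == l)%:R * 1))) => [|l _]; last by rewrite eP; ring.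
  rewrite big_split /= sumr_const card_ord sumrB !sum_deltar subrr addr0.
  by rewrite -[(_ - _) *+ _]mulr_natl mulrA mulVf // mul1r.
(* The negatives of the fundamental weights, with the origin as last vertex; the [F k] are the
   simple roots and the lowest root, of length [sqrt 2] before scaling by [r]. *)
pose v (i : 'I_n.+1) : 'rV[R]_n := - \sum_(j : 'I_n.+1 | (j <= i)%N) (e j - m).
pose F k := r *: (e k - e (ordS k)).
have cnt (k i : 'I_n.+1) : \sum_(j : 'I_n.+1 | (j <= i)%N) (k == j)%:R = (k <= i)%N%:R :> R.
  rewrite big_mkcond /= (eq_bigr (fun j : 'I_n.+1 => (k == j)%:R * (j <= i)%N%:R)).
    by rewrite sum_deltar.
  by move=> j _; case: ifP; rewrite ?mulr1 ?mulr0.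
have Fv k i : dot (F k) (v i) = - (r * ((k == i)%:R - (k == ord_max)%:R)).
  rewrite dotZl dotNr mulrN dot_sumr (eq_bigr _ (fun j _ => em k (ordS k) j)) sumrB
    !cnt.
  congr (- (_ * _)); have := ltn_ord k; rewrite ltnS leq_eqVlt => /orP[/eqP kn|kn].
    rewrite ordS_max // leq0n kn -[k == i]val_eqE -[k == _]val_eqE /= kn eqxx.
    by rewrite eqn_leq (_ : (i <= n)%N) ?andbT -1?ltnS.
  rewrite ordS_val // -[k == i]val_eqE -[k == _]val_eqE /= (ltn_eqF kn) subr0.
  by case: ltngtP => _; rewrite /= ?subr0 ?subrr.
have sv : is_simplex v.
  move=> c c0 cv k; have : dot (F k) (\sum_i c i *: v i) = 0 by rewrite cv dot0r.
  rewrite dot_sumr (eq_bigr (fun i => - r * ((k == i)%:R * c i - (k == ord_max)%:R * c i))).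
    rewrite -mulr_sumr sumrB sum_deltar -mulr_sumr c0 mulr0 subr0 => /eqP.
    by rewrite mulf_eq0 oppr_eq0 gt_eqF //= => /eqP.
  by move=> i _; rewrite dotZr Fv; ring.
have FF i j : dot (F i) (F j) = cycle_gram R i j.
  rewrite dotZ eP (inj_eq (@ordS_inj _)) -expr2 r2 /cycle_gram (eq_sym (ordS i));
    by field.
exists v => //; exists id; split; first by exists id.
suff N k : outward_normal v k = F k by move=> i j; rewrite !N.
apply/esym/outward_normal_unique => //; split=> [|j l jk lk|j jk].
- by rewrite /enorm FF /cycle_gram eqxx eq_sym (negbTE (ordS_neq hn k)) /= addr0
  mul0r subr0 sqrtr1.
- by rewrite dotB !Fv ![k == _]eq_sym (negbTE jk) (negbTE lk) subrr.
- by rewrite dotB !Fv eqxx [k == j]eq_sym (negbTE jk) /=; lra.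
Qed.

(** * Topological preliminaries *)

Section Topology.
Variables (R : realType) (n : nat).
Implicit Types (a u x y : 'rV[R]_n) (b : R).

Lemma cvg_sumr (T : Type) (F : set_system T) {FF : Filter F} (V : normedModType R)
    (I : Type) (r : seq I) (f : I -> T -> V) (l : I -> V) :
  (forall i, f i t @[t --> F] --> l i) ->
  \sum_(i <- r) f i t @[t --> F] --> \sum_(i <- r) l i.
Proof.
move=> fl; elim: r => [|i r IH].
  by under eq_cvg do rewrite big_nil; rewrite big_nil; exact: cvg_cst.
under eq_cvg do rewrite big_cons; rewrite big_cons; exact: cvgD.
Qed.

Lemma cvg_dot (T : Type) (F : set_system T) {FF : Filter F}
    (f g : T -> 'rV[R]_n) x y :
  f t @[t --> F] --> x -> g t @[t --> F] --> y ->
  dot (f t) (g t) @[t --> F] --> dot x y.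
Proof.
move=> fx gy; apply: cvg_sumr => i; apply: cvgM.
- exact: (cvg_comp _ _ fx (@coord_continuous _ _ _ _ _ _)).
- exact: (cvg_comp _ _ gy (@coord_continuous _ _ _ _ _ _)).
Qed.

Lemma continuous_dot a : continuous (dot a).
Proof.
move=> x; apply: (@cvg_dot _ (nbhs x) _ (fun=> a) id); first exact: cvg_cst.
exact: cvg_id.
Qed.

Lemma cvg_reflection (T : Type) (F : set_system T) {FF : Filter F}
    (a : T -> 'rV[R]_n) (b : T -> R) (g : T -> 'rV[R]_n) a0 b0 x : a0 != 0 ->
  a t @[t --> F] --> a0 -> b t @[t --> F] --> b0 -> g t @[t --> F] --> x ->
  reflection (a t) (b t) (g t) @[t --> F] --> reflection a0 b0 x.
Proof.
move=> a0N aP bP gP; apply: cvgB => //; apply: cvgZ => //.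
apply: cvgM; last by apply: cvgV; [rewrite dot_eq0|exact: cvg_dot].
by apply: cvgM; [exact: cvg_cst|apply: cvgB => //; exact: cvg_dot].
Qed.

Lemma continuous_line x u : continuous (fun t : R => x + t *: u).
Proof.
move=> t; apply: cvgD; first exact: cvg_cst.
by apply: cvgZ; [exact: cvg_id|exact: cvg_cst].
Qed.

Lemma closure_line (A : set 'rV[R]_n) x u :
  (forall t : R, 0 < t < 1 -> A (x + t *: u)) -> closure A x.
Proof.
move=> At B Bx.
have : \forall t \near (0 : R)^'+, B (x + t *: u) /\ 0 < t < 1.
  near=> t; split; last by apply/andP; split;
    near: t; [exact: nbhs_right_gt|exact: nbhs_right_lt].
  near: t; apply: cvg_within; apply: (@continuous_line x u 0).
  by rewrite scale0r addr0.
by move=> /filter_ex[t [Bt t01]]; exists (x + t *: u); split => //; exact: At.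
Unshelve. all: by end_near. Qed.

Lemma convex_connected (A : set 'rV[R]_n) :
  (forall x y (t : R), A x -> A y -> 0 <= t <= 1 -> A (x + t *: (y - x))) ->
  connected A.
Proof.
move=> cA; have [->|/set0P[x Ax]] := eqVneq A set0; first exact: connected0.
pose L y := [set x + t *: (y - x) | t in `[0, 1]].
have -> : A = \bigcup_(y in A) L y.
  apply/seteqP; split=> [y Ay|_ [y Ay [t /= + <-]]].
    exists y => //; exists 1; first by rewrite /= in_itv /= ler01 lexx.
    by rewrite scale1r addrC subrK.
  by rewrite in_itv /= => t01; exact: cA.
apply: bigcup_connected => [|y Ay].
  exists x => y Ay; exists 0; first by rewrite /= in_itv /= ler01 lexx.
  by rewrite scale0r addr0.
apply: connected_continuous_connected; first exact: segment_connected.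
by apply: continuous_subspaceT; exact: continuous_line.
Qed.

Lemma connected_halfspace (C : set 'rV[R]_n) a b x :
  connected C -> (forall y, C y -> dot a y <> b) -> C x -> b < dot a x ->
  forall y, C y -> b < dot a y.
Proof.
move=> cC CN Cx bx y Cy; rewrite ltNge; apply/negP => yb.
have : connected (dot a @` C).
  apply: connected_continuous_connected => //.
  by apply: continuous_subspaceT; exact: continuous_dot.
move/connected_intervalP => /(_ (dot a y) (dot a x) _ _ b)[||| z Cz zb].
- by exists y.
- by exists x.
- by rewrite yb ltW.
- exact: CN Cz zb.
Qed.

Lemma open_halfspace a b : open [set x : 'rV[R]_n | b < dot a x].
Proof.
rewrite -[X in open X]/(dot a @^-1` [set r | b < r]).
by apply: open_comp; [move=> x _; exact: continuous_dot|exact: open_gt].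
Qed.

Lemma closed_halfspace a b : closed [set x : 'rV[R]_n | b <= dot a x].
Proof.
rewrite -[X in closed X]/(dot a @^-1` [set r | b <= r]).
by apply: preimage_closed; [move=> x _; exact: continuous_dot|exact: closed_ge].
Qed.

Lemma closure_halfspace (C : set 'rV[R]_n) a b :
  (forall y, C y -> b < dot a y) -> forall y, closure C y -> b <= dot a y.
Proof.
move=> Cb y Cy; have := @closed_halfspace a b y; apply.
by apply: closureS Cy => z /Cb/ltW.
Qed.

(** Moving from the foot [p] of the perpendicular inside the first hyperplane shows that [a'] is
    orthogonal to everything orthogonal to [a]. *)
Lemma hyperplane_subset a b a' b' : a != 0 -> hyperplane a b `<=` hyperplane a' b' ->
  exists c, a' = c *: a /\ b' = c * b.
Proof.
move=> a0 sub; have aa : dot a a != 0 by rewrite dot_eq0.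
pose p := (b / dot a a) *: a.
have ap : dot a p = b by rewrite dotZr divfK.
have a'p : dot a' p = b' by exact: sub.
have perp u : dot a u = 0 -> dot a' u = 0.
  move=> au; have : dot a' (p + u) = b' by apply: sub;
    rewrite /hyperplane /= dotDr ap au addr0.
  by rewrite dotDr a'p => h; lra.
exists (dot a' a / dot a a); have e : a' = (dot a' a / dot a a) *: a.
  apply/eqP; rewrite -subr_eq0; apply/eqP/dot_eq0P; set u := _ - _.
  have au : dot a u = 0 by rewrite /u dotB dotZr divfK // dotC subrr.
  by rewrite {1}/u dotBl dotZl au mulr0 subr0 perp.
by split=> //; rewrite -a'p {1}e dotZl ap.
Qed.

Lemma reflection_hyperplane_eq a b a' b' : a != 0 -> a' != 0 ->
  hyperplane a b = hyperplane a' b' -> reflection a' b' = reflection a b.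
Proof.
move=> a0 a0' H; have [|c [a'E ->]] := @hyperplane_subset a b a' b' a0;
  first by rewrite H.
have c0 : c != 0 by apply: contra_neq a0' => c0; rewrite a'E c0 scale0r.
by rewrite a'E; apply/funext => x; rewrite reflection_scale.
Qed.

Lemma reflection_in_hyperplane a b r : a != 0 ->
  reflection_in (hyperplane a b) r -> r = reflection a b.
Proof.
by move=> a0 [a' [b' [a0' H ->]]]; apply: reflection_hyperplane_eq.
Qed.

End Topology.

(** * The affine Weyl group and its chamber *)

Section FacetGroup.
Variables (R : realType) (n : nat) (v : 'I_n.+1 -> 'rV[R]_n).
Hypotheses (hn : (0 < n)%N) (sv : is_simplex v).

Definition facet_reflection i :=
  reflection (outward_normal v i) (dot (outward_normal v i) (v (ordS i))).

Lemma facet_group_closed : transformation_group (facet_group v).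
Proof.
split=> [A [[]]|g h gG hG A AP|g h gG gh hg A AP] //.
- by case: (AP) => -[_ + _] _; apply; [exact: gG|exact: hG].
- by case: (AP) => -[_ _ +] _; apply; [exact: gG|exact: gh|].
Qed.

Lemma facet_reflection_in i : reflection_in (facet_span v i) (facet_reflection i).
Proof.
exists (outward_normal v i), (dot (outward_normal v i) (v (ordS i))).
by split=> //; [exact: normal_neq0|exact: facet_spanE].
Qed.

Lemma facet_group_reflection i : facet_group v (facet_reflection i).
Proof. by move=> A [_]; apply; exists i; exact: facet_reflection_in. Qed.

Lemma facet_group_sub P : transformation_group P ->
  (forall i, P (facet_reflection i)) -> facet_group v `<=` P.
Proof.
move=> PT Pr g; apply; split=> // r [i]; rewrite facet_spanE //.
by move=> /(reflection_in_hyperplane (normal_neq0 hn sv i)) ->; exact: Pr.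
Qed.

(** [transformation_group] only absorbs inverses already given as functions; their existence follows
    from minimality, applied to the elements having an inverse in the group. *)
Lemma facet_group_inverse g : facet_group v g ->
  exists h, [/\ facet_group v h, cancel g h & cancel h g].
Proof.
have [G1 GM GV] := facet_group_closed.
suff sub : facet_group v `<=`
    [set g : 'rV[R]_n -> 'rV[R]_n |
      exists h, [/\ facet_group v h, cancel g h & cancel h g]] by exact: sub.
apply: facet_group_sub.
  split=> [|g1 g2 [h1 [G1' c1 d1]] [h2 [G2 c2 d2]]|g1 h [k [Gk gk kg]] gh hg].
  - by exists id.
  - exists (h2 \o h1); split; [exact: GM|exact: can_comp|exact: can_comp].
  - exists g1; split=> //; exact: GV Gk kg gk.
move=> i; exists (facet_reflection i); split; first exact: facet_group_reflection.
- exact: reflectionK (normal_neq0 hn sv i).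
- exact: reflectionK (normal_neq0 hn sv i).
Qed.
End FacetGroup.

Lemma int_unit_itv (R : realType) (t : int) : ~ (0 < (t%:~R : R) < 1).
Proof.
move=> /andP[]; rewrite ltr0z -[1]/(1%:~R) ltr_int => t0.
by rewrite -[1]add0r ltzD1 leNgt t0.
Qed.

Section AffineWeylGroup.
Variables (R : realType) (n : nat) (v : 'I_n.+1 -> 'rV[R]_n).
Variable s : 'I_n.+1 -> 'I_n.+1.
Hypotheses (hn : (0 < n)%N) (sv : is_simplex v) (sP : cyclic_normals v s).

Local Notation lam := (alcove_bary v s).
Local Notation Y := (coordA v s).

Definition affine_permutation (g : 'rV[R]_n -> 'rV[R]_n) : Prop :=
  exists (p : {perm 'I_n.+1}) (t : 'I_n.+1 -> int),
    forall y i, Y i (g y) = Y (p i) y + (t i)%:~R.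

(** By [coordA_subS], the amount [lam k y] moved from coordinate [k] to its successor is their
    difference, plus 1 for the wall [ord_max]: a transposition, with a translation only at that
    wall. *)
Lemma wall_reflection_affine_permutation k :
  affine_permutation (wall_reflection v s k).
Proof.
exists (tperm k (ordS k)).
exists (fun i => (k == ord_max)%:R * ((ordS k == i)%:R - (k == i)%:R)) => y i.
rewrite coordA_wall_reflection //.
have := coordA_subS hn sv sP k y => /eqP; rewrite -(subr_eq0 _ (_ - _)) => /eqP lE.
have kS : (ordS k == k) = false by rewrite (negbTE (ordS_neq hn k)).
rewrite rmorphM rmorphB /= !rmorph_nat.
case: tpermP => [->|->|/eqP ik /eqP iS].
- by rewrite eqxx kS /=; lra.
- by rewrite eqxx eq_sym kS /=; lra.
- by rewrite eq_sym (negbTE iS) eq_sym (negbTE ik) subrr !mulr0.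
Qed.

Lemma facet_group_affine_permutation g : facet_group v g -> affine_permutation g.
Proof.
suff sub : facet_group v `<=` affine_permutation by exact: sub.
apply: facet_group_sub => //; last first.
  move=> i; have [[t _ tK] _] := sP; rewrite -(tK i).
  exact: wall_reflection_affine_permutation.
split=> [|g1 h [p [t gP]] [q [u hP]]|g1 h [p [t gP]] gh hg].
- by exists 1%g, (fun=> 0) => y i; rewrite perm1 addr0.
- exists (p * q)%g, (fun i => t i + u (p i)) => y i /=.
  by rewrite gP hP permM rmorphD /=; ring.
- exists (p^-1)%g, (fun i => - t ((p^-1)%g i)) => y i.
  by rewrite rmorphN /= -{2}(hg y) gP permKV addrK.
Qed.

Lemma coordA_sum (i : 'I_n.+1) y :
  Y i y = Y ord0 y - \sum_(0 <= k < i) lam (inord k) y.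
Proof.
case: i => m; elim: m => [|m IH] lm /=.
  by rewrite big_geq // subr0; congr (Y _ y); apply/val_inj.
have := coordA_subS hn sv sP (Ordinal (ltnW lm)) y.
have -> : ordS (Ordinal (ltnW lm)) = Ordinal lm by apply/val_inj; rewrite /= modn_small.
rewrite -[_ == ord_max]val_eqE /= (ltn_eqF (lm : (m < n)%N)) subr0 IH big_nat_recr
  //= => h.
have -> : inord m = Ordinal (ltnW lm) by apply/val_inj; rewrite /= inordK // ltnW.
by rewrite -h; ring.
Qed.

(** The difference sums the [lam k] for [i <= k < j]: positive numbers with total 1 over all [k],
    and [lam j] at least is left out. *)
Lemma coordA_itv y (i j : 'I_n.+1) : (forall k, 0 < lam k y) -> (i < j)%N ->
  0 < Y i y - Y j y < 1.
Proof.
move=> lam0 ij; rewrite (coordA_sum i) (coordA_sum j).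
have pos a b : (a < b)%N -> 0 < \sum_(a <= k < b) lam (inord k) y.
  by move=> ab; rewrite big_ltn // ltr_pwDl // sumr_ge0 // => k _; exact: ltW.
have tot : \sum_(0 <= k < n.+1) lam (inord k) y = 1.
  by rewrite -(sum_lam hn sv sP y) big_mkord; apply: eq_bigr => k _; rewrite inord_val.
have j1 : \sum_(0 <= k < j) lam (inord k) y < 1.
  have := pos j n.+1 (ltn_ord j); move: tot.
  by rewrite (@big_cat_nat _ _ _ j) //= ?(ltnW (ltn_ord j)) // => <- ?; rewrite ltrDl.
have i0 : 0 <= \sum_(0 <= k < i) lam (inord k) y by apply: sumr_ge0 => k _; exact: ltW.
move: j1; rewrite (@big_cat_nat _ _ _ i 0 j) //= ?(ltnW ij) //.
by have := pos _ _ ij => h1 h2; apply/andP; split; lra.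
Qed.

(** If the permutation moved [i], two distinct coordinates of [y] would differ by an integer,
    against [coordA_itv]; so it is trivial and the translation vanishes. *)
Lemma open_alcove_stabilizer g y : facet_group v g -> (forall k, 0 < lam k y) ->
  g y = y -> g = id.
Proof.
move=> /facet_group_affine_permutation[p [t gP]] lam0 gy.
have e i : Y i y - Y (p i) y = (t i)%:~R by rewrite -{1}gy gP; ring.
have fixp i : p i = i.
  apply/val_inj/eqP; rewrite eqn_leq; apply/andP; split; rewrite leqNgt;
    apply/negP => lt.
  - by apply: (@int_unit_itv R (t i)); rewrite -e; exact: coordA_itv.
  - apply: (@int_unit_itv R (- t i)); rewrite rmorphN /= -e opprB; exact: coordA_itv.
apply/funext => x; apply: (coordA_inj hn sv sP) => i.
by rewrite gP -e fixp subrr addr0.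
Qed.

Definition barycenter := \sum_i n.+1%:R^-1 *: v i.

Lemma lam_barycenter k : lam k barycenter = n.+1%:R^-1.
Proof.
rewrite /alcove_bary bary_comb // sumr_const card_ord -[_ *+ _]mulr_natl mulfV //.
Qed.

Lemma lam_barycenter_gt0 k : 0 < lam k barycenter.
Proof. by rewrite lam_barycenter invr_gt0 ltr0Sn. Qed.

(* [n.+1 * lam k (g barycenter)] is an integer, so all these numbers are at
   least 1 as soon as they are positive. *)
Lemma barycenter_orbit g : facet_group v g ->
  (forall k, 0 < lam k (g barycenter)) -> g = id.
Proof.
move=> Gg pos; apply: (@open_alcove_stabilizer _ barycenter) => //.
  exact: lam_barycenter_gt0.
have [p [t gP]] := facet_group_affine_permutation Gg.
pose N : R := n.+1%:R; have N0 : N != 0 by rewrite pnatr_eq0.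
have N_gt0 : 0 < N by rewrite ltr0Sn.
have Yb i : Y i barycenter = Y ord0 barycenter - i%:R / N.
  rewrite (coordA_sum i) (eq_bigr (fun=> N^-1)) => [|k _]; last exact: lam_barycenter.
  by rewrite sumr_const_nat subn0 mulr_natl.
have ge k : N^-1 <= lam k (g barycenter).
  have := coordA_subS hn sv sP k (g barycenter);
    rewrite !gP (Yb (p k)) (Yb (p (ordS k))) => lE.
  pose z : int := (p (ordS k))%:Z - (p k)%:Z +
    n.+1%:Z * (t k - t (ordS k) + (k == ord_max)%:Z).
  have zE : lam k (g barycenter) = z%:~R / N.
    have -> : lam k (g barycenter) =
        lam k (g barycenter) - (k == ord_max)%:R + (k == ord_max)%:R by ring.
    rewrite -lE /z !(rmorphD, rmorphM, rmorphN) /= -!pmulrn -/N.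
    by field.
  rewrite zE -[leLHS]mul1r ler_pM2r ?invr_gt0 // -[1]/(1%:~R) ler_int.
  have := pos k; rewrite zE pmulr_lgt0 ?invr_gt0 // ltr0z.
  by rewrite -[1]add0r lezD1.
(* [n.+1] numbers, each at least [1 / n.+1] and summing to 1, are all equal to it. *)
have eq k : lam k (g barycenter) = N^-1.
  apply/eqP; rewrite -subr_eq0.
  have /eqP : \sum_k (lam k (g barycenter) - N^-1) = 0.
    by rewrite sumrB sum_lam // sumr_const card_ord -[_ *+ _]mulr_natl mulfV // subrr.
  rewrite psumr_eq0 => [/allP/(_ k (mem_index_enum _)) //|i _].
  by rewrite subr_ge0.
by apply: (lam_inj hn sv sP) => k; rewrite eq lam_barycenter.
Qed.

Lemma lam_affine k : exists a b, forall z, lam k z = dot a z - b.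
Proof.
pose q := outward_normal v (s k); pose c := height v (s k).
exists (- c^-1 *: q), (- c^-1 * dot q (v (ordS (s k)))) => z.
by rewrite /alcove_bary /bary dotZl dotB -/q -/c; ring.
Qed.

(** Provides the continuity that makes the preimage of the open alcove under [g] open. *)
Lemma lam_orbit_affine g k : facet_group v g ->
  exists a b, forall z, lam k (g z) = dot a z - b.
Proof.
move=> /facet_group_affine_permutation[p [t gP]].
pose c := (2 * alcove_size v s ^+ 2)^-1; pose i := p k; pose j := p (ordS k).
exists (c *: (E v s i - E v s j)).
exists (c * dot (E v s i - E v s j) (v (s ord_max)) - (t k)%:~R + (t (ordS k))%:~R
        - (k == ord_max)%:R) => z.
have := coordA_subS hn sv sP k (g z); rewrite !gP /coordA -/c -/i -/j => e.
rewrite dotZl !(dotBl (E v s i)); move: e; rewrite !(dotB _ z) => e.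
by apply/eqP; rewrite -subr_eq0; apply/eqP; lra.
Qed.

Definition open_alcove : set 'rV[R]_n := [set y | forall k, 0 < lam k y].

(** The isolating neighbourhood of [g] consists of the maps sending the barycenter into the image of
    the open alcove under [g]; if [h] is such a map in the group, [barycenter_orbit] gives
    [g' \o h = id]. *)
Lemma facet_group_discrete : discrete_group (facet_group v).
Proof.
move=> g Gg; split; first exact: mem_set.
have [g' [Gg' gg' g'g]] := facet_group_inverse hn sv Gg.
have [_ GM _] := facet_group_closed v.
pose O := [set z | forall k, 0 < lam k (g' z)].
have oO : open O.
  rewrite openE => z Oz;
    apply: (@filter_forall _ _ (fun k z => 0 < lam k (g' z)) (nbhs z)) => k.
  have [a [b gE]] := lam_orbit_affine k Gg'.
  have : nbhs z [set y | b < dot a y].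
    by apply: open_nbhs_nbhs; split; [exact: open_halfspace|rewrite /= -subr_gt0 -gE].
  by apply: filterS => y /=; rewrite gE subr_gt0.
exists [set h | h @` [set barycenter] `<=` O].
  apply: open_nbhs_nbhs; split; first by apply: compact_open_open => //;
    exact: compact_set1.
  by move=> _ [_ -> <-] k; rewrite gg'; exact: lam_barycenter_gt0.
apply/seteqP; split=> [h [hO Gh]|_ ->]; last first.
  by split=> // _ [_ -> <-] k; rewrite gg'; exact: lam_barycenter_gt0.
have gh : g' \o h = id.
  apply: barycenter_orbit; first exact: GM.
  by move=> k; apply: hO; exists barycenter.
by apply/funext => x; rewrite -[LHS]g'g -[g' (h x)]/((g' \o h) x) gh.
Qed.

Lemma open_alcove_no_mirror y : open_alcove y -> ~ mirror_union (facet_group v) y.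
Proof.
move=> Ay [H [r [[a [b [a0 -> ->]]] Gr /= ay]]].
have fix_y : reflection a b y = y by apply/reflection_fix.
have rid := open_alcove_stabilizer Gr Ay fix_y.
have : reflection a b (y + a) = y + a by rewrite rid.
move/(reflection_fix _ _ a0); rewrite dotDr ay => h.
by have := dot_gt0 a0; rewrite -(subrr b) -{1}h; lra.
Qed.

Lemma open_alcove_convex x y (t : R) : open_alcove x -> open_alcove y ->
  0 <= t <= 1 -> open_alcove (x + t *: (y - x)).
Proof.
move=> Ax Ay /andP[t0 t1] k; have [a [b lE]] := lam_affine k.
have := Ax k; have := Ay k; rewrite !lE !(dotDr, dotZr, dotNr) => h1 h2.
by have [|] := lerP t (1/2) => ht; nra.
Qed.

Lemma simplex_hull_lam : simplex_hull v = [set y | forall k, 0 <= lam k y].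
Proof.
rewrite simplex_hullE //; have [[t _ tK] _] := sP.
apply/seteqP; split=> y /= hy k; first exact: hy.
by rewrite -(tK k); exact: hy.
Qed.

Lemma closure_open_alcove : closure open_alcove = simplex_hull v.
Proof.
rewrite simplex_hull_lam; apply/seteqP; split=> y.
- move=> cy k; have [a [b lE]] := lam_affine k; rewrite lE subr_ge0.
  by apply: closure_halfspace cy => z /(_ k); rewrite lE subr_gt0.
- move=> /= hy; apply: (@closure_line _ _ _ _ (barycenter - y)) => t /andP[t0 t1] k.
  have [a [b lE]] := lam_affine k.
  have := hy k; have := lam_barycenter_gt0 k;
    rewrite !lE !(dotDr, dotZr, dotNr) => h1 h2.
  by nra.
Qed.

(** The open alcove is convex and free of mirrors, hence inside the component; its walls are
    mirrors, which a connected mirror-free set cannot cross. *)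
Lemma alcove_chamber : fundamental_chamber (facet_group v) (simplex_hull v).
Proof.
have bA : open_alcove barycenter by exact: lam_barycenter_gt0.
exists barycenter; first exact: open_alcove_no_mirror.
rewrite -closure_open_alcove; congr closure; apply/seteqP; split=> y.
  apply: connected_component_max => //; first exact: open_alcove_no_mirror.
  exact/convex_connected/open_alcove_convex.
have cC := @component_connected _ (~` mirror_union (facet_group v)) barycenter.
have Cb : connected_component (~` mirror_union (facet_group v)) barycenter barycenter.
  by apply: connected_component_refl; exact: open_alcove_no_mirror.
move=> Cy k; have [a [b lE]] := lam_affine k; rewrite lE subr_gt0.
apply: (connected_halfspace cC _ Cb) Cy; last by rewrite -subr_gt0 -lE; exact: bA.
move=> z /connected_component_sub Mz zb; apply: Mz.
exists (facet_span v (s k)), (facet_reflection v (s k)); split.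
- exact: facet_reflection_in.
- exact: facet_group_reflection.
- rewrite facet_spanE // /hyperplane /=; have := lE z; rewrite zb subrr => /eqP.
  rewrite /alcove_bary /bary mulf_eq0 invr_eq0 (negbTE (height_neq0 hn sv _)) orbF
    dotB subr_eq0.
  by move/eqP.
Qed.
End AffineWeylGroup.

Lemma cyclic_normals_generates_A (R : realType) (n : nat) (v : 'I_n.+1 -> 'rV[R]_n) s :
  (0 < n)%N -> is_simplex v -> cyclic_normals v s -> generates_A v.
Proof.
move=> hn sv sP; split=> //; first exact: facet_group_discrete sP.
exists v; last exact: alcove_chamber sP.
by apply/coxeter_simplex_AP => //; split=> //; exists s.
Qed.

(** * Covering space by alcoves *)

Section GenericPoint.
Variables (R : realType) (n : nat).

Lemma exists_notin (l : seq R) : exists t, t \notin l.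
Proof.
suff [t lt] : exists t, forall x, x \in l -> x < t.
  by exists t; apply/negP => /lt; rewrite ltxx.
elim: l => [|x l [t IH]]; first by exists 0.
exists (`|x| + `|t| + 1) => y; rewrite inE => /orP[/eqP->|/IH yt].
- by have := ler_norm x; have := normr_ge0 t; lra.
- by have := ler_norm t; have := normr_ge0 x; lra.
Qed.

(** Induction on [l]: a direction good for the tail is perturbed along [u], each linear form
    excluding at most one [t]. *)
Lemma generic_direction (a : 'rV[R]_n) (l : seq 'rV[R]_n) :
  (forall g, g \in l -> exists u, dot a u = 0 /\ dot g u != 0) ->
  exists d, dot a d = 0 /\ forall g, g \in l -> dot g d != 0.
Proof.
elim: l => [_|g l IH gl]; first by exists 0; rewrite dot0r.
have [|d [ad ld]] := IH; first by move=> x xl; apply: gl; rewrite inE xl orbT.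
have [u [au gu]] := gl g (mem_head _ _).
have [t tN] := exists_notin [seq - dot x d / dot x u | x <- g :: l].
exists (d + t *: u); split; first by rewrite dotDr dotZr ad au mulr0 addr0.
move=> x xl; rewrite dotDr dotZr; have [xu|xu] := eqVneq (dot x u) 0.
  rewrite xu mulr0 addr0; apply: ld; move: xl; rewrite inE => /orP[/eqP xg|//].
  by rewrite -xg xu eqxx in gu.
apply: contra tN => /eqP e; apply/mapP; exists x => //.
by apply: (mulIf xu); rewrite divfK //; lra.
Qed.

(** Each pair [(i, m)] excludes a single [t]; countably many values cannot fill [[0, 1]], whose
    Lebesgue measure is 1. *)
Lemma generic_parameter (I : countType) (A B : I -> R) : (forall i, B i != 0) ->
  exists t, forall i (m : int), A i + t * B i != m%:~R.
Proof.
move=> B0; apply: contrapT => /forallNP bad.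
pose F (p : I * int) : R := (p.2%:~R - A p.1) / B p.1.
have cI : countable `[0 : R, 1]%classic.
  apply: (@sub_countable _ _ _ (F @` setT)); last first.
    by apply: sub_countable (card_image_le _ _) _; exact: countableP.
  apply: subset_card_le => t _; apply: contrapT => tN; apply: (bad t) => i m.
  apply/eqP => e; apply: tN; exists (i, m) => //; rewrite /F /= -e.
  by rewrite addrAC subrr add0r mulfK.
have := countable_lebesgue_measure0 cI.
rewrite lebesgue_measure_itv /= lte01 oppr0 adde0 => /eqP.
by rewrite onee_eq0.
Qed.

Lemma dist_int_gt0 (x : R) : (forall m : int, x != m%:~R) ->
  exists2 d : R, 0 < d & forall m : int, d <= `|x - m%:~R|.
Proof.
move=> xN; pose z := Num.floor x.
have z1 : z%:~R < x by rewrite lt_neqAle eq_sym xN floor_le.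
have z2 : x < (z + 1)%:~R by exact: floorD1_gt.
exists (Num.min (x - z%:~R) ((z + 1)%:~R - x)); first by rewrite lt_min !subr_gt0 z1.
move=> m; rewrite ge_min; have [mz|zm] := leP m z.
- apply/orP; left; have : (m%:~R : R) <= z%:~R by rewrite ler_int.
  by move=> h; apply: le_trans (ler_norm _); lra.
- apply/orP; right; have : ((z + 1)%:~R : R) <= m%:~R by rewrite ler_int lezD1.
  by move=> h; rewrite distrC; apply: le_trans (ler_norm _); lra.
Qed.
End GenericPoint.

Section AlcoveCovering.
Variables (R : realType) (n : nat) (v : 'I_n.+1 -> 'rV[R]_n).
Variable s : 'I_n.+1 -> 'I_n.+1.
Hypotheses (hn : (0 < n)%N) (sv : is_simplex v) (sP : cyclic_normals v s).

Local Notation lam := (alcove_bary v s).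
Local Notation Y := (coordA v s).
Local Notation h := (alcove_size v s).

Lemma wall_reflection_dist k x y :
  let y' := wall_reflection v s k y in
  dot (y' - x) (y' - x) = dot (y - x) (y - x) + 4 * h ^+ 2 * lam k y * lam k x.
Proof.
have := lam_add hn sv sP k x (y - x); rewrite addrC subrK => lE /=.
rewrite wall_reflectionE //; set f := outward_normal v (s k) in lE *.
have f1 : dot f f = 1 by exact: normal_dot1.
have h0 : h != 0 by exact: alcove_size_neq0.
have fE : dot f (y - x) = h * (lam k x - lam k y) by rewrite lE; field.
rewrite addrAC; set z := y - x in fE *.
rewrite !(dotDl z) !(dotDr _ z) !dotZl !dotZr f1 (dotC z f) fE; ring.
Qed.

(* Reflecting a point in a wall that separates it from the barycenter brings it
   closer to the barycenter, by an amount bounded below. *)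
Lemma alcove_covering (Q : set 'rV[R]_n) (d : R) q :
  (forall k y, Q y -> Q (wall_reflection v s k y)) -> 0 < d -> Q q ->
  (forall i j, i != j -> forall m : int, d <= `|Y i q - Y j q - m%:~R|) ->
  exists2 q', Q q' & open_alcove v s q'.
Proof.
move=> Qr d0; pose x := barycenter v.
have h0 : 0 < h by exact: alcove_size_gt0.
(* The guaranteed drop of the squared distance in [wall_reflection_dist], when [lam k y <= - d] and
   [lam k x = 1 / n.+1]. *)
pose c := 4 * h ^+ 2 * d * n.+1%:R^-1.
have c0 : 0 < c by rewrite !mulr_gt0 ?invr_gt0 ?ltr0Sn ?exprn_gt0.
suff rec N : forall y, dot (y - x) (y - x) < N%:R * c -> Q y ->
    (forall i j, i != j -> forall m : int, d <= `|Y i y - Y j y - m%:~R|) ->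
    exists2 q', Q q' & open_alcove v s q'.
  apply: (rec (Num.truncn (dot (q - x) (q - x) / c)).+1).
  rewrite -ltr_pdivrMr //; exact: truncnS_gt.
elim: N => [y|N IH y yN Qy gy]; first by rewrite mul0r ltNge dot_ge0.
have [|/existsNP[k /negP kN]] := pselect (open_alcove v s y); first by exists y.
rewrite -leNgt in kN.
(* [lam k y] is a coordinate difference up to an integer, so its absolute value is at least [d]. *)
have lk : lam k y <= - d.
  have kS : k != ordS k by rewrite eq_sym ordS_neq.
  have := gy _ _ kS (- (k == ord_max)%:Z);
    rewrite (coordA_subS hn sv sP k y) rmorphN /=.
  by rewrite -pmulrn opprK subrK ler0_norm // => ?; lra.
apply: (IH (wall_reflection v s k y)); last 2 first.
- exact: Qr.
(* Permuting coordinates and adding integers preserves the margin [d]. *)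
- have [p [t pP]] := wall_reflection_affine_permutation hn sv sP k.
  move=> i j ij m; rewrite !pP.
  have pij : p i != p j by rewrite (inj_eq perm_inj).
  have := gy _ _ pij (m - t i + t j); rewrite rmorphD rmorphB /=.
  by congr (_ <= `|_|); ring.
rewrite wall_reflection_dist lam_barycenter //.
apply: le_lt_trans (_ : dot (y - x) (y - x) - c < _); last first.
  by move: yN; rewrite -natr1; lra.
rewrite lerD2l /c; set A := 4 * h ^+ 2; set B := n.+1%:R^-1.
have A0 : 0 < A * B by rewrite !mulr_gt0 ?invr_gt0 ?ltr0Sn ?exprn_gt0.
have -> : A * lam k y * B = A * B * lam k y by ring.
have -> : - (A * d * B) = A * B * - d by ring.
by rewrite ler_pM2l.
Qed.

(** If [a] is no multiple of a root, some direction inside the hyperplane is transversal to all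
    roots; on a line in that direction, all but countably many points have no integral
    difference. *)
Lemma nongeneric_hyperplane_root a b : a != 0 ->
  (forall q, dot a q = b -> exists i j, i != j /\ exists m : int, Y i q - Y j q = m%:~R) ->
  exists c i j, i != j /\ a = c *: (E v s i - E v s j).
Proof.
move=> a0 ng; apply: contrapT => notroot.
have h0 : h != 0 by exact: alcove_size_neq0.
pose I := {p : 'I_n.+1 * 'I_n.+1 | p.1 != p.2}.
pose g (p : I) := E v s (val p).1 - E v s (val p).2.
have perp p : exists u, dot a u = 0 /\ dot (g p) u != 0.
  apply: contrapT => /forallNP nu; case: p nu => -[i j] /= ij nu.
  have [|c [gE _]] := @hyperplane_subset _ _ a 0 (E v s i - E v s j) 0 a0.
    move=> u /= au; apply: contrapT => /eqP gu; apply: (nu u); split => //.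
  apply: notroot; exists c^-1, i, j; split => //; rewrite gE scalerA mulVf ?scale1r //.
  apply/eqP => c0; have := E_dotB hn sv sP i i j.
  rewrite gE c0 scale0r dot0r eqxx (negbTE ij) subr0 mulr1 => /eqP.
  by rewrite eq_sym mulf_eq0 expf_eq0 /= (negbTE h0) pnatr_eq0.
have [d [ad gd]] : exists d, dot a d = 0 /\
    forall g', g' \in [seq g p | p : I] -> dot g' d != 0.
  by apply: generic_direction => _ /mapP[p _ ->]; exact: perp.
pose q0 := (b / dot a a) *: a.
have K0 : 2 * h ^+ 2 != 0 by rewrite mulf_neq0 // ?expf_neq0 // pnatr_eq0.
have [|t tP] := @generic_parameter _ I (fun p => Y (val p).1 q0 - Y (val p).2 q0)
    (fun p => dot (g p) d / (2 * h ^+ 2)).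
  move=> p; rewrite mulf_neq0 ?invr_eq0 //; apply: gd.
  by apply/mapP; exists p => //; rewrite mem_enum.
have [|i [j [ij [m mE]]]] := ng (q0 + t *: d).
  by rewrite dotDr !dotZr ad mulr0 addr0 divfK // dot_eq0.
have /eqP := tP (exist _ (i, j) ij : I) m; apply; rewrite /= -mE /g /=.
have Yt l : Y l (q0 + t *: d) = Y l q0 + t * dot (E v s l) d / (2 * h ^+ 2).
  by rewrite /coordA addrAC dotDr dotZr mulrDl.
by rewrite !Yt (dotBl (E v s i)); field.
Qed.
End AlcoveCovering.

(** * Groups whose chamber is an alcove *)

Lemma reflectionN (R : realType) (n : nat) (a : 'rV[R]_n) (b : R) :
  reflection (- a) (- b) = reflection a b.
Proof.
by apply/funext => z; rewrite -[- a]scaleN1r -[- b]mulN1r reflection_scale.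
Qed.

Section Chamber.
Variables (R : realType) (n : nat) (G : set ('rV[R]_n -> 'rV[R]_n)).
Variables (w : 'I_n.+1 -> 'rV[R]_n) (s : 'I_n.+1 -> 'I_n.+1) (x : 'rV[R]_n).
Hypotheses (hn : (0 < n)%N) (sw : is_simplex w) (sP : cyclic_normals w s).
Hypotheses (GT : transformation_group G) (Gd : discrete_group G).
Hypothesis Mx : ~ mirror_union G x.
Local Notation C := (connected_component (~` mirror_union G) x).
Hypothesis hullC : simplex_hull w = closure C.

Local Notation lam := (alcove_bary w s).
Local Notation h := (alcove_size w s).
Local Notation W i := (w (s i)).

Let Cx : C x.
Proof. exact: connected_component_refl. Qed.

Lemma mirror_avoids (a : 'rV[R]_n) b y : a != 0 -> G (reflection a b) ->
  ~ mirror_union G y -> dot a y <> b.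
Proof.
move=> a0 Ga My ay; apply: My; exists (hyperplane a b), (reflection a b).
by split=> //; exists a, b.
Qed.

Lemma affine_combination (a : 'rV[R]_n) b y :
  dot a y - b = \sum_i lam i y * (dot a (W i) - b).
Proof.
rewrite {1}(baryE hn sw y) dot_sumr -[b in LHS]mul1r -(sum_bary hn sw y) mulr_suml
  -sumrB.
rewrite (reindex s) /=; last exact: onW_bij sP.1.
by apply: eq_bigr => i _; rewrite dotZr mulrBr.
Qed.

Lemma mirror_side (a : 'rV[R]_n) b : a != 0 -> G (reflection a b) -> b < dot a x ->
  forall i, b <= dot a (W i).
Proof.
move=> a0 Ga bx i; apply: (@closure_halfspace _ _ C).
  apply: (connected_halfspace (@component_connected _ _ _) _ Cx bx) => y Cy.
  by apply: mirror_avoids => //; exact: connected_component_sub Cy.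
rewrite -hullC simplex_hullE // => k /=; rewrite bary_vertex //; exact: ler0n.
Qed.

Lemma mirror_vertices_neq0 (a : 'rV[R]_n) b : a != 0 ->
  ~ (forall i, dot a (W i) = b).
Proof.
move=> a0 aW; have e y : dot a y - b = 0.
  by rewrite affine_combination big1 // => i _; rewrite aW subrr mulr0.
have := dot_gt0 a0; have := e a; have := e 0; rewrite dot0r => h1 h2; lra.
Qed.

(** [C] is not known to be the open alcove, so the mirror is tested at the vertices, which lie in
    its closure: an affine function nonnegative there and zero at an interior point vanishes at all
    of them. *)
Lemma open_alcove_avoids_mirrors y : open_alcove w s y -> ~ mirror_union G y.
Proof.
move=> Ay [H [r [[a [b [a0 -> ->]]] Gr /= ay]]].
have {}ay : dot a y = b by [].
wlog bx : a b a0 Gr ay / b < dot a x.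
  move=> wl; have [bx|xb|bx] := ltgtP b (dot a x); first exact: (wl a b).
  - apply: (wl (- a) (- b)); rewrite ?oppr_eq0 ?dotNl ?ay ?ltrN2 //.
    by rewrite reflectionN.
  - exact: (mirror_avoids a0 Gr Mx (esym bx)).
have aW := mirror_side a0 Gr bx.
apply: (@mirror_vertices_neq0 a b a0) => i; have := affine_combination a b y.
rewrite ay subrr => /esym/eqP; rewrite psumr_eq0 =>
  [/allP/(_ i (mem_index_enum _))|j _].
  by rewrite /= mulf_eq0 gt_eqF //= subr_eq0 => /eqP.
by rewrite mulr_ge0 ?subr_ge0 // ltW.
Qed.

(* The chamber is cut out by the mirrors, so a point outside the simplex is
   separated from it by one of them. *)
Lemma separating_mirror p k : lam k p < 0 ->
  exists a b, [/\ a != 0, G (reflection a b), b < dot a x & dot a p <= b].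
Proof.
move=> kp; apply: contrapT => nsep.
(* The points on the same side of every mirror as [x]: a convex set free of mirrors, hence contained
   in [C]. *)
pose U : set 'rV[R]_n := [set y | forall a b, a != 0 -> G (reflection a b) ->
  b < dot a x -> b < dot a y].
have Up : U p.
  move=> a b a0 Ga bx; rewrite ltNge; apply/negP => pb.
  by apply: nsep; exists a, b.
have UC : U `<=` C.
  apply: connected_component_max.
  - by move=> a b.
  - move=> y Uy [H [r [[a [b [a0 -> ->]]] Gr /= ay]]].
    have {}ay : dot a y = b by [].
    have [bx|xb|bx] := ltgtP b (dot a x).
    + by have := Uy a b a0 Gr bx; rewrite ay ltxx.
    + have : - b < dot (- a) y; last by rewrite dotNl ay ltxx.
      apply: Uy; rewrite ?oppr_eq0 ?dotNl ?ltrN2 //.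
      by rewrite reflectionN.
    + exact: (mirror_avoids a0 Gr Mx (esym bx)).
  - apply: convex_connected => y z t Uy Uz /andP[t0 t1] a b a0 Ga bx.
    have := Uy a b a0 Ga bx; have := Uz a b a0 Ga bx.
    rewrite !(dotDr, dotZr, dotNr) => h1 h2.
    by have [|] := lerP t (1/2) => ht; nra.
have : closure C p by apply: subset_closure; exact: UC.
rewrite -hullC (simplex_hull_lam hn sw sP) => /(_ k).
by rewrite leNgt kp.
Qed.

(** A mirror separating the chamber from a point just beyond facet [k] must pass close to the other
    vertices; scaling its equation to 1 at [W k] makes the equations comparable as [m] grows. *)
Lemma mirror_near_wall k (m : nat) : exists p : 'rV[R]_n * R,
  [/\ p.1 != 0, G (reflection p.1 p.2), dot p.1 (W k) - p.2 = 1
    & forall i, i != k -> 0 <= dot p.1 (W i) - p.2 <= n%:R / m.+1%:R].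
Proof.
have n0 : 0 < n%:R :> R by rewrite ltr0n.
have nN0 : n%:R != 0 :> R by rewrite gt_eqF.
(* The point [p] lies opposite the centre of facet [k], with coordinate [- e] at [k]. The equation
   is nonpositive at [p] and nonnegative at the vertices, which bounds each other value by [n * e]
   times the one at [W k]. *)
pose e : R := m.+1%:R^-1; have e0 : 0 < e by rewrite invr_gt0 ltr0Sn.
pose c i : R := if i == k then - e else (1 + e) / n%:R.
have c1 : \sum_i c i = 1.
  rewrite (bigD1 k) //= /c eqxx (eq_bigr (fun=> (1 + e) / n%:R)) => [|i /negbTE-> //].
  rewrite sumr_const cardC1 card_ord /= -[_ *+ n]mulr_natl; field; exact: nN0.
pose p := \sum_i c i *: W i.
have lp i : lam i p = c i.
  have [[t tK sK] _] := sP.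
  have -> : p = \sum_j (c \o t) j *: w j.
    rewrite [RHS](reindex s) /=; last exact: onW_bij sP.1.
    by apply: eq_bigr => j _; rewrite tK.
  rewrite /alcove_bary bary_comb ?[(c \o t) _]/= ?tK // (reindex s) /=.
    by rewrite -[RHS]c1; apply: eq_bigr => j _; rewrite tK.
  exact: onW_bij sP.1.
have [|a [b [a0 Ga bx pb]]] := @separating_mirror p k.
  by rewrite lp /c eqxx oppr_lt0.
have aW i : 0 <= dot a (W i) - b by rewrite subr_ge0; exact: mirror_side.
have bound i : i != k -> dot a (W i) - b <= n%:R * e * (dot a (W k) - b).
  move=> ik; have := affine_combination a b p.
  rewrite (bigD1 k) //= (bigD1 i) //= !lp /c eqxx (negbTE ik).
  set S := \sum_(_ | _) _; have S0 : 0 <= S.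
    apply: sumr_ge0 => j /andP[jk _]; rewrite lp /c (negbTE jk).
    by rewrite mulr_ge0 // divr_ge0 ?(ltW n0) //; lra.
  set A := dot a (W i) - b; set B := dot a (W k) - b => eq.
  have -> : A = n%:R * (A / n%:R) by field.
  rewrite -mulrA ler_pM2l //.
  have : 0 <= e * (A / n%:R) by rewrite mulr_ge0 ?(ltW e0) // divr_ge0 ?(ltW n0) //;
    exact: aW.
  have split_e : (1 + e) / n%:R * A = A / n%:R + e * (A / n%:R) by field.
  by move: eq; rewrite split_e => eq ?; lra.
have ak : 0 < dot a (W k) - b.
  rewrite lt_neqAle aW andbT eq_sym; apply/eqP => ak0.
  apply: (@mirror_vertices_neq0 a b a0) => i.
  have [->|ik] := eqVneq i k; first by move/eqP: ak0; rewrite subr_eq0 => /eqP.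
  by have := bound i ik; have := aW i; rewrite ak0 mulr0 => *; lra.
set A := dot a (W k) - b in ak bound.
have AN0 : A != 0 by rewrite gt_eqF.
have AV0 : A^-1 != 0 by rewrite invr_eq0.
exists (A^-1 *: a, A^-1 * b) => /=; split.
- by rewrite scaler_eq0 negb_or AV0.
- rewrite (_ : reflection _ _ = reflection a b) //; apply/funext => z.
  exact: reflection_scale.
- by rewrite dotZl -mulrBr mulVf.
- move=> i ik; rewrite dotZl -mulrBr mulr_ge0 ?invr_ge0 ?(ltW ak) //= mulrC.
  by rewrite ler_pdivrMr //; exact: bound.
Qed.

(** The same normalisation for the wall itself: this equation is [lam k], with value 1 at [W k] and
    0 on the facet. *)
Lemma wall_reflection_limit k :
  let a0 := - h^-1 *: outward_normal w (s k) in
  wall_reflection w s k = reflection a0 (dot a0 (W k) - 1).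
Proof.
move=> a0; apply/funext => z; rewrite /wall_reflection.
have hN0 : h != 0 by exact: alcove_size_neq0.
have -> : dot a0 (W k) - 1 = - h^-1 * dot (outward_normal w (s k)) (w (ordS (s k))).
  rewrite /a0 dotZl (normal_dot_vertex hn sw (s k) (s k)) (heightE hn sw sP) eqxx mul1r.
  by field.
by rewrite reflection_scale // oppr_eq0 invr_eq0.
Qed.

(** An affine function is the combination of the [lam i] with its vertex values as coefficients;
    [- h^-1 *: outward_normal w (s i)] is the gradient of [lam i]. Convergence at the vertices thus
    gives convergence of the normals. *)
Lemma mirror_normalE (a : 'rV[R]_n) b :
  a = \sum_i (dot a (W i) - b) *: (- h^-1 *: outward_normal w (s i)).
Proof.
apply/eqP; rewrite -subr_eq0; apply/eqP/dot_eq0P; set z := _ - _; rewrite {1}/z dotBl.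
have -> : dot a z = (dot a z - b) - (dot a 0 - b) by rewrite dot0r; ring.
rewrite !affine_combination -sumrB dot_suml -sumrB big1 // => i _.
have := lam_add hn sw sP i 0 z; rewrite add0r => ->.
by rewrite !dotZl; ring.
Qed.

(* Mirrors separating the simplex from points approaching a wall converge to
   that wall; by discreteness they are eventually equal to it. *)
Lemma wall_reflection_in k : G (wall_reflection w s k).
Proof.
have [G1 GM GV] := GT.
have /choice[p pP] := mirror_near_wall k.
pose a m := (p m).1; pose b m := (p m).2.
pose r m := reflection (a m) (b m).
pose e m i := dot (a m) (W i) - b m.
have rG m : G (r m) by case: (pP m).
have aN0 m : a m != 0 by case: (pP m).
pose a0 := - h^-1 *: outward_normal w (s k).
have a0N : a0 != 0.
  have hN0 : h != 0 by exact: alcove_size_neq0.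
  by rewrite scaler_eq0 negb_or oppr_eq0 invr_eq0 hN0 normal_neq0.
have ek m : e m k = 1 by case: (pP m).
have ecvg i : e m i @[m --> \oo] --> ((i == k)%:R : R).
  have [->|ik] := eqVneq i k.
    by under eq_cvg do rewrite ek; exact: cvg_cst.
  apply: (@squeeze_cvgr _ _ _ _ (fun=> 0) (fun m => n%:R * harmonic m)).
  - by near=> m; case: (pP m) => _ _ _ /(_ i ik).
  - exact: cvg_cst.
  - rewrite -[X in _ --> X](mulr0 n%:R); apply: cvgM; first exact: cvg_cst.
    exact: cvg_harmonic.
have acvg : a m @[m --> \oo] --> a0.
  have -> : a = (fun m => \sum_i e m i *: (- h^-1 *: outward_normal w (s i))).
    by apply/funext => m; rewrite /e -mirror_normalE.
  have -> : a0 = \sum_i (i == k)%:R *: (- h^-1 *: outward_normal w (s i)).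
    rewrite (bigD1 k) //= eqxx scale1r big1 ?addr0 // => i /negbTE ->.
    by rewrite scale0r.
  by apply: cvg_sumr => i; apply: cvgZ; [exact: ecvg|exact: cvg_cst].
have bcvg : b m @[m --> \oo] --> dot a0 (W k) - 1.
  have -> : b = (fun m => dot (a m) (W k) - 1).
    by apply/funext => m; rewrite -(ek m) /e; ring.
  by apply: cvgB; [apply: cvg_dot => //; exact: cvg_cst|exact: cvg_cst].
have acvgS : a m.+1 @[m --> \oo] --> a0 by rewrite (cvg_shiftS a).
have bcvgS : b m.+1 @[m --> \oo] --> dot a0 (W k) - 1 by rewrite (cvg_shiftS b).
pose r0 := wall_reflection w s k.
have r0E : r0 = reflection a0 (dot a0 (W k) - 1) by exact: wall_reflection_limit.
have r0K : cancel r0 r0 by rewrite r0E; exact: reflectionK.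
(* The limit [r0] is not yet known to be in [G], but these products and their limit [id] are. *)
have rcvg : (fun m => r m \o r m.+1) @ \oo --> (id : {compact-open, 'rV[R]_n -> 'rV[R]_n}).
  apply/compact_open_cvgP => K O cK oO KO.
  (* Compactness turns joint convergence in the point and the index into one index valid on all of
     [K]. *)
  have /compact_near_coveringP/(_ _ \oo (fun m z => O (r m (r m.+1 z))) _) := cK.
  have near z : K z -> \forall z' \near z & m \near \oo, O (r m (r m.+1 z')).
    move=> Kz.
    have : (fun q : 'rV[R]_n * nat => r q.2 (r q.2.+1 q.1)) @ (nbhs z, \oo) --> r0 (r0 z).
      rewrite r0E /r; apply: cvg_reflection => //; last apply: cvg_reflection => //.
      + exact: (cvg_comp _ _ cvg_snd acvg).
      + exact: (cvg_comp _ _ cvg_snd bcvg).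
      + exact: (cvg_comp _ _ cvg_snd acvgS).
      + exact: (cvg_comp _ _ cvg_snd bcvgS).
      + exact: cvg_fst.
    by apply; rewrite r0K; apply: open_nbhs_nbhs; split=> //; apply: KO; exists z.
  by move=> /(_ near); apply: filterS => m mK _ [z Kz <-]; exact: mK.
have [_ [V Vid VG]] := Gd G1.
have [M _ MV] : \forall m \near \oo, V (r m \o r m.+1) by exact: rcvg.
(* The products are eventually the identity; reflections being involutions, consecutive ones
   coincide. *)
have rS m : (M <= m)%N -> r m.+1 = r m.
  move=> Mm; have : (V `&` G) (r m \o r m.+1) by split; [exact: MV|exact: GM].
  rewrite VG => rr; apply/funext => z.
  by rewrite -[LHS](reflectionK (b m) (aN0 m)) -/(r m)
    -[r m (r m.+1 z)]/((r m \o r m.+1) z) rr.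
have rM m : (M <= m)%N -> r m = r M.
  elim: m => [|m IH]; first by rewrite leqn0 => /eqP->.
  by rewrite leq_eqVlt => /orP[/eqP-> //|Mm]; rewrite rS ?IH.
suff -> : wall_reflection w s k = r M by [].
apply/funext => z; rewrite -/r0.
have rz : r m z @[m --> \oo] --> r0 z.
  by rewrite r0E /r; apply: cvg_reflection => //; exact: cvg_cst.
have rz' : r m z @[m --> \oo] --> r M z.
  apply: cvg_near_cst; exists M => // m /= Mm; by rewrite rM.
exact: (cvg_unique _ rz rz').
Unshelve. all: by end_near. Qed.

Lemma mirror_union_wall_reflection k y : mirror_union G y ->
  mirror_union G (wall_reflection w s k y).
Proof.
have [G1 GM GV] := GT; have Gk := wall_reflection_in k.
set t := wall_reflection w s k in Gk *.
move=> [H [r [[a [b [a0 -> ->]]] Gr ay]]].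
have {}ay : dot a y = b by [].
pose f := outward_normal w (s k); pose d := dot f (w (ordS (s k))).
have f1 : dot f f = 1 by exact: normal_dot1.
have tK : cancel t t by exact: reflectionK (normal_neq0 hn sw _).
pose a' := a - (2 * dot a f) *: f; pose b' := b - 2 * dot a f * d.
have tE : t \o reflection a b \o t = reflection a' b' by exact: reflection_conj.
have a'0 : a' != 0.
  rewrite -dot_eq0 (_ : dot a' a' = dot a a) ?dot_eq0 //.
  by rewrite /a' !(dotDl, dotDr, dotNl, dotNr, dotZl, dotZr) f1 (dotC f a); ring.
exists (hyperplane a' b'), (reflection a' b'); split.
- by exists a', b'.
- by rewrite -tE; exact: (GM _ _ (GM _ _ Gk Gr) Gk).
- by apply/reflection_fix => //; rewrite -tE /= tK; congr t; exact/reflection_fix.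
Qed.

Lemma chamber_mirror_root (a : 'rV[R]_n) b : a != 0 -> G (reflection a b) ->
  exists c i j, i != j /\ a = c *: (E w s i - E w s j).
Proof.
move=> a0 Ga; apply: (nongeneric_hyperplane_root hn sw sP a0) => q aq.
apply: contrapT => gen; pose Y := coordA w s.
have genP i j : i != j -> forall m : int, Y i q - Y j q != m%:~R.
  by move=> ij m; apply/eqP => e; apply: gen; exists i, j; split => //; exists m.
(* Finitely many pairs, so one margin [d] serves them all. *)
have : \forall d \near (0 : R)^'+, forall ij : 'I_n.+1 * 'I_n.+1, ij.1 != ij.2 ->
    forall m : int, d <= `|Y ij.1 q - Y ij.2 q - m%:~R|.
  apply: filter_forall => -[i j] /=; have [->|ij] := eqVneq i j; first by near=> d.
  have [e e0 eP] := dist_int_gt0 (genP i j ij).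
  near=> d => _ m; apply: le_trans (eP m); near: d; exact: nbhs_right_le.
move=> dnear; have pd : \forall d \near (0 : R)^'+, 0 < d /\
    forall ij : 'I_n.+1 * 'I_n.+1, ij.1 != ij.2 ->
      forall m : int, d <= `|Y ij.1 q - Y ij.2 q - m%:~R|.
  by near=> d; split; near: d; [exact: nbhs_right_gt|exact: dnear].
have [d [d0 dP]] := filter_ex pd.
have Mq : mirror_union G q.
  by exists (hyperplane a b), (reflection a b);
    split; [exists a, b|exact: Ga|exact: aq].
have [|q' Mq' /open_alcove_avoids_mirrors//] := alcove_covering hn sw sP
  mirror_union_wall_reflection d0 Mq.
by move=> i j ij m; exact: (dP (i, j)).
Unshelve. all: by end_near. Qed.
End Chamber.

(** * Classification of the generating simplices *)

Lemma generates_A_cyclic_normals (R : realType) (n : nat) (v : 'I_n.+1 -> 'rV[R]_n) :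
  (0 < n)%N -> generates_A v -> is_simplex v /\ exists s, cyclic_normals v s.
Proof.
move=> hn [sv Gd [w /(coxeter_simplex_AP _ hn)[sw [s sP]] [x Mx hullC]]]; split=> //.
apply: (root_normals_cyclic hn sw sP sv) => k.
apply: (chamber_mirror_root hn sw sP (facet_group_closed v) Gd Mx hullC).
  exact: normal_neq0.
exact: facet_group_reflection.
Qed.

Theorem theorem1 (R : realType) (n : nat) (hn : (1 <= n)%N) :
  (exists F : set ('I_n.+1 -> 'rV[R]_n),
    [/\ is_family F,
        forall v, F v -> generates_A v,
        forall F', is_family F' -> (exists2 v, F' v & generates_A v) ->
          similar_families F F'
      & forall v, coxeter_simplex_A v <->
          exists2 phi, similarity phi & F (phi \o v)]) /\
  (forall v : 'I_n.+1 -> 'rV[R]_n, generates_A v -> coxeter_simplex_A v).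
Proof.
split; last by move=> v /(generates_A_cyclic_normals hn) ?; exact/coxeter_simplex_AP.
have [v0 sv0 [s0 sP0]] := exists_cyclic_normals R hn.
exists (Defs.family v0); split.
- by exists v0.
- move=> v vF; have [s sP] := family_cyclic_normals hn sv0 sP0 vF.
  exact: cyclic_normals_generates_A (proj1 vF) sP.
- move=> _ [v' sv' ->] [v [_ vv'] /(generates_A_cyclic_normals hn)[sv [s sP]]].
  (* A family depends on its reference simplex only through the set of normals, so the generating
     member can take that role. *)
  rewrite (_ : Defs.family v' = Defs.family v); last by rewrite /Defs.family vv'.
  exact: alcove_families_similar sP0 sv sP.
- move=> v; rewrite coxeter_simplex_AP //; split.
  + move=> [sv [s sP]].
    have iso := alcove_map_isometry hn sv sP sv0 sP0.
    exists (alcove_map v s v0 s0); first by exists 1; [exact: ltr01|exact: iso].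
    by apply: alcove_map_family => //; split.
  + move=> [phi simphi vF]; have [s sP] := family_cyclic_normals hn sv0 sP0 vF.
    have sv : is_simplex v.
      by case: simphi => k k0 phiP; apply/(similarity_simplex k0 phiP); case: vF.
    by split=> //; exists s; exact: cyclic_normals_similarity simphi sv sP.
Qed.
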